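(* Let $\epsilon_d\in(0,1)$ and $p,q\in(0,\tfrac12)$. For every sequence $\{\Delta(n)\}$ of shared-key lengths, 1. if $q\le p$, then the covert capacity satisfies $r^{*}_{\Delta(n),\epsilon_d}(p,q)=0$; 2. if $p<q$, then $r^{*}_{\Delta(n),\epsilon_d}(p,q)\le t(q,\epsilon_d)\,I_B(p,q)$.
   Context: All logarithms are binary; $\mathrm{wt}_H$ is Hamming weight; $\oplus$ is addition modulo 2; $Q(x)=\frac{1}{\sqrt{2\pi}}\int_x^\infty e^{-u^2/2}du$. Model. A code of blocklength $n$ with $N$ messages and $\Delta(n)$ bits of shared key consists of an encoder and a decoder. The encoder $\Psi(T,M,K)$ takes the transmission status $T\in\{0,1\}$, a message $M$ (uniform on $\{1,\dots,N\}$ if $T=1$; $M=0$ if $T=0$) and a shared key $K$ uniform on $\{0,1\}^{\Delta(n)}$, independent of $M$. If $T=0$ the output is $\mathbf{X}=\mathbf{0}\in\{0,1\}^n$; if $T=1$ the output $\mathbf{X}=\Psi(1,M,K)\in\{0,1\}^n$ is arbitrary. The codebook $\mathcal{C}$ (collection of outputs of $\Psi(1,\cdot,\cdot)$), encoder and decoder are known to everyone; $K$ is unknown to the adversary, as are $T,M$. The relative throughput is $r=(\log N)/\sqrt n$. The adversary observes $\mathbf{Z}=\mathbf{X}\oplus\bar{\mathbf{S}}$ with $\bar{\mathbf{S}}$ having i.i.d. Bern$(q)$ coordinates. An estimator is a map $\Phi:\{0,1\}^n\to\{0,1\}$, $\widehat T=\Phi(\mathbf{Z})$, with $P_{\mathrm{FA}}(\Phi)=\mathbb{P}(\widehat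 T=1\mid T=0)$, $P_{\mathrm{MD}}(\Phi)=\mathbb{P}(\widehat T=0\mid T=1)$. A sequence of codes is $(1-\epsilon_d)$-covert if $\liminf_{n\to\infty}\min_\Phi\{P_{\mathrm{FA}}(\Phi)+P_{\mathrm{MD}}(\Phi)\}\ge1-\epsilon_d$. A jamming strategy is a conditional distribution $W_{\mathbf{S}|\mathbf{Z},\mathcal{C}}$ producing $\mathbf{S}\in\{0,1\}^n$ with $\mathrm{wt}_H(\mathbf{S})\le pn$ from $\mathbf{Z}$ and knowledge of the code. The receiver observes $\mathbf{Y}=\mathbf{X}\oplus\mathbf{S}$ and outputs $\widehat M=\Gamma(\mathbf{Y},K)\in\{0,1,\dots,N\}$. The probability of error is $$P_{\mathrm{err}}=\max_{W_{\mathbf{S}|\mathbf{Z},\mathcal{C}}}\Big(\mathbb{P}(\widehat M\ne0\mid T=0)+\mathbb{P}(\widehat M\ne M\mid T=1)\Big).$$ A relative throughput $r$ is achievable (for given $p,q,\Delta(n),\epsilon_d$) if there is an infinite sequence of codes with $\Delta(n)$ bits of shared key, each of relative throughput at least $r$, with $\limsup_{n\to\infty}P_{\mathrm{err}}=0$ and which is $(1-\epsilon_d)$-covert. The covert capacity $r^{*}_{\Delta(n),\epsilon_d}(p,q)$ is the supremum of all achievable relative throughputs. Quantities: $$t(q,\epsilon_d)=\frac{2\sqrt{q(1-q)}}{1-2q}\,Q^{-1}\!\left(\frac{1-\epsilon_d}{2}\right),$$ $$I_B(p,q)=\frac{p(q-1)}{q}\log\left(\frac{(q-p+pq)(1-p)}{p^2(1-q)}\right)+\log\left(\frac{q-p+pq}{pq}\right)\quad(p\le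 q).$$ *)

(* Defs.v *)
From HB Require Import structures.
From mathcomp Require Import all_boot all_order all_algebra.
From mathcomp Require Import all_classical all_reals all_analysis.
Set Implicit Arguments.
Unset Strict Implicit.
Unset Printing Implicit Defensive.
Import Order.TTheory GRing.Theory Num.Theory.
Local Open Scope classical_set_scope.
Local Open Scope ring_scope.

(* Binary words; the matrix addition over 'F_2 is the bitwise sum modulo 2. *)
Notation word n := 'rV['F_2]_n.

Definition wtH n (x : word n) : nat := #|[pred i | x 0 i != 0]|.

Definition log2 (R : realType) (x : R) : R := ln x / ln 2.

Definition gaussQ (R : realType) (x : R) : R :=
  (Num.sqrt (2 * pi))^-1 *
  \int[lebesgue_measure]_(u in `[x, +oo[) expR (- (u ^+ 2 / 2)).

(* gaussQ is a bijection from R to ]0, 1[; the default value 0 is only taken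
   outside of that interval. *)
Definition gaussQ_inv (R : realType) (y : R) : R :=
  xget 0 [set x | gaussQ x = y].

(* Messages are numbered 1, ..., nmsg; the index 0 stands for no transmission,
   both as the encoder input when the status is false and as a decoder
   output. *)
Record code (n d : nat) := Code {
  nmsg : nat;
  nmsg_gt0 : (0 < nmsg)%N;
  enc : bool -> 'I_nmsg.+1 -> word d -> word n;
  enc_silent : forall k, enc false ord0 k = 0;
  dec : word n -> word d -> 'I_nmsg.+1
}.

Arguments enc {n d} C T m k : rename.
Arguments dec {n d} C y k : rename.

Definition rel_throughput (R : realType) n d (C : code n d) : R :=
  log2 (nmsg C)%:R / Num.sqrt n%:R.

Definition bern_word (R : realType) (q : R) n (x : word n) : R :=
  \prod_(i < n) (if x 0 i != 0 then q else 1 - q).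

Section Model.
Context (R : realType) (n d : nat) (C : code n d).
Implicit Types (p q : R) (T : bool) (Phi : {ffun word n -> bool})
  (W : word n -> word n -> R).

(* Law of the message given the transmission status. *)
Definition msg_prob T (m : 'I_(nmsg C).+1) : R :=
  if T then (m != ord0)%:R / (nmsg C)%:R else (m == ord0)%:R.

(* Joint law of the message, the key and the adversary's observation, given
   the transmission status. *)
Definition law_MKZ q T (m : 'I_(nmsg C).+1) (k : word d) (z : word n) : R :=
  msg_prob T m * (2 ^+ d)^-1 * bern_word q (z - enc C T m k).

Definition P_FA q Phi : R :=
  \sum_m \sum_k \sum_(z | Phi z == true) law_MKZ q false m k z.

Definition P_MD q Phi : R :=
  \sum_m \sum_k \sum_(z | Phi z == false) law_MKZ q true m k z.

(* There are finitely many estimators, so this infimum is a minimum. *)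
Definition min_detection q : R :=
  inf [set P_FA q Phi + P_MD q Phi | Phi in [set: {ffun word n -> bool}]].

(* W z s is the conditional probability of the jamming word s given the
   observation z. *)
Definition jamming p W : Prop :=
  [/\ forall z s, 0 <= W z s,
      forall z, \sum_s W z s = 1 &
      forall z s, W z s != 0 -> (wtH s)%:R <= p * n%:R].

(* Probability that the decoder output differs from the message, given the
   status T; when T is false the message is almost surely 0. *)
Definition err_prob q W T : R :=
  \sum_m \sum_k \sum_z \sum_(s | dec C (enc C T m k + s) k != m)
    law_MKZ q T m k z * W z s.

(* The code is fixed here, hence W may depend on it. The set is nonempty for
   0 <= p and bounded by 2. *)
Definition P_err p q : R :=
  sup [set err_prob q W false + err_prob q W true | W in jamming p].

End Model.

(* The codes are indexed by their position j in the sequence; the blocklengths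
   b j are positive and increase to infinity, but need not take every value. *)
Definition achievable (R : realType) (p q : R) (Delta : nat -> nat) (eps : R)
    (r : R) : Prop :=
  exists (b : nat -> nat) (C : forall j, code (b j) (Delta (b j))),
    [/\ (forall j, (0 < b j)%N) /\ {homo b : i j / (i < j)%N},
        forall j, r <= rel_throughput R (C j),
        limn_esup (fun j => (P_err (C j) p q)%:E) = 0%E &
        ((1 - eps)%:E <= limn_einf (fun j => (min_detection (C j) q)%:E))%E].

(* Supremum taken in [0, +oo]: it is 0 when nothing is achievable, which does
   happen since even a single message requires detecting the transmission. *)
Definition covert_capacity (R : realType) (p q : R) (Delta : nat -> nat)
    (eps : R) : \bar R :=
  Order.max 0%E (ereal_sup [set r%:E | r in achievable p q Delta eps]).

Definition weight_bound (R : realType) (q eps : R) : R :=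
  2 * Num.sqrt (q * (1 - q)) / (1 - 2 * q) * gaussQ_inv ((1 - eps) / 2).

Definition I_B (R : realType) (p q : R) : R :=
  p * (q - 1) / q *
    log2 ((q - p + p * q) * (1 - p) / (p ^+ 2 * (1 - q)))
  + log2 ((q - p + p * q) / (p * q)).

(* Main.v *)
(* The jammer copies each observed one with probability theta and stays silent
   otherwise, for any theta < 1 with theta q < p; it respects the budget pn up to
   an event of small probability. The channel from X to Y is then memoryless,
   with output laws Bern(theta q) for X_i = 0 and Bern(1 - theta (1 - q)) for
   X_i = 1, whose binary divergence is ln 2 * I_B(theta q, q).
   Covertness: the detector that thresholds wt(Z) at half the weight shift forces
   a positive fraction of the codewords to have weight at most T sqrt n, for every
   T > t(q, eps_d); this uses the central limit theorem for binomials.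
   Throughput: for a fixed key the decoding regions are disjoint, so under the
   output law of the zero word they have average mass at most 1/N; a change of
   measure along a codeword of weight at most T sqrt n multiplies this by at most
   exp((T KL + eta) sqrt n). Hence a vanishing error forces r <= T I_B(theta q, q).
   Letting T -> t(q, eps_d) and theta q -> min(p, q) gives both parts, since
   I_B(q, q) = 0. *)
Require Import Defs.
From mathcomp Require Import all_boot all_order all_algebra.
From mathcomp Require Import all_classical all_reals all_analysis.
From mathcomp Require Import measurable_realfun ring lra.
Set Implicit Arguments.
Unset Strict Implicit.
Unset Printing Implicit Defensive.
Import Order.TTheory GRing.Theory Num.Theory.
Import numFieldNormedType.Exports.
Local Open Scope classical_set_scope.
Local Open Scope ring_scope.

(** * The Gaussian tail function *)

Section GaussianTail.
Context {R : realType}.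
Implicit Types x y a : R.

Local Notation gauss := (normal_prob (0 : R) 1).

Let normal_pdf01 x :
  normal_pdf 0 1 x = (Num.sqrt (2 * pi))^-1 * expR (- (x ^+ 2 / 2)).
Proof.
rewrite normal_pdfE ?oner_eq0// /normal_peak /normal_fun.
by rewrite expr1n mul1r subr0 mulNr -mulr_natl.
Qed.

Let integrable_pdf01 (D : set R) : measurable D ->
  lebesgue_measure.-integrable D (EFin \o normal_pdf (0 : R) 1).
Proof. by move=> mD; exact: integrableS (integrable_normal_pdf 0 1). Qed.

Lemma gaussQE x : gaussQ x = \int[lebesgue_measure]_(u in `[x, +oo[) normal_pdf 0 1 u.
Proof.
rewrite /gaussQ -RintegralZl//.
  by apply: eq_Rintegral => u _; rewrite normal_pdf01.
have -> : (EFin \o (fun u : R => expR (- (u ^+ 2 / 2)))) =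
          (fun u => ((Num.sqrt (2 * pi))%:E * (normal_pdf 0 1 u)%:E)%E).
  apply/funext => u /=; rewrite normal_pdf01 -EFinM mulrA divff ?mul1r//.
  by rewrite gt_eqF// sqrtr_gt0 mulr_gt0// pi_gt0.
exact/integrableZl/integrable_pdf01.
Qed.

(** As a normal probability, the tail inherits the bound by 1, the complement rule and continuity
    from above. *)
Lemma EFin_gaussQ x : (gaussQ x)%:E = gauss `[x, +oo[.
Proof.
rewrite gaussQE /Rintegral fineK//.
by apply: integrable_fin_num => //; exact: integrable_pdf01.
Qed.

Lemma gaussQ_ge0 x : 0 <= gaussQ x.
Proof. by rewrite -lee_fin EFin_gaussQ. Qed.

Lemma gaussQ_le1 x : gaussQ x <= 1.
Proof. by rewrite -lee_fin EFin_gaussQ probability_le1. Qed.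

(** The density is even, so reflection turns the tail above [- x] into the mass below [x]. *)
Lemma gaussQN x : gaussQ (- x) = 1 - gaussQ x.
Proof.
have pdfN u : normal_pdf (0 : R) 1 (- u) = normal_pdf 0 1 u.
  by rewrite !normal_pdf01 sqrrN.
have cpdf : continuous (normal_pdf (0 : R) 1).
  by apply: continuous_normal_pdf; rewrite oner_eq0.
suff H : gauss `[- x, +oo[ = (1 - gauss `[x, +oo[)%E.
  by apply: EFin_inj; rewrite EFin_gaussQ H EFinB EFin_gaussQ.
rewrite -probability_setC// setCitvr /= /normal_prob.
rewrite integral_itv_bndo_bndc; last first.
  by apply/measurable_EFinP/measurable_funTS; exact: measurable_normal_pdf.
have := @ge0_integration_by_substitutionNy _ (normal_pdf (0 : R) 1) (- x).
rewrite opprK => H; apply: etrans (esym (H _ _)).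
- by apply: eq_integral => u _; rewrite /= pdfN.
- exact: continuous_subspaceT.
- by move=> u _; exact: normal_pdf_ge0.
Qed.

Lemma gaussQB x y : x < y ->
  gaussQ x - gaussQ y = \int[lebesgue_measure]_(u in `[x, y]) normal_pdf 0 1 u.
Proof.
move=> xy; rewrite !gaussQE; apply/eqP; rewrite subr_eq addrC -subr_eq; apply/eqP.
rewrite Rintegral_itvB//; last 2 first.
  by apply: integrable_pdf01.
  by rewrite bnd_simp ltW.
by rewrite Rintegral_itv_obnd_cbnd//; exact: integrable_pdf01.
Qed.

(** Monotonicity, continuity and the comparison with binomial weights all follow from this by
    choosing [lo] and [hi]. *)
Lemma gaussQB_bounds x y (lo hi : R) : x < y ->
  (forall u, x <= u <= y -> lo <= normal_pdf 0 1 u <= hi) ->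
  lo * (y - x) <= gaussQ x - gaussQ y <= hi * (y - x).
Proof.
move=> xy H; rewrite gaussQB//.
have cst_int (c : R) :
    c * (y - x) = \int[lebesgue_measure]_(u in `[x, y]) c.
  by rewrite Rintegral_cst//= lebesgue_measure_itv/= lte_fin xy.
have icst (c : R) :
    lebesgue_measure.-integrable [set` `[x, y]] (EFin \o (fun _ : R => c)).
  apply: continuous_compact_integrable; first exact: segment_compact.
  exact/continuous_subspaceT/cst_continuous.
rewrite !cst_int; apply/andP; split; apply: le_Rintegral => //;
  try exact: integrable_pdf01.
  by move=> u /=; rewrite in_itv/= => /H/andP[].
by move=> u /=; rewrite in_itv/= => /H/andP[].
Qed.

(** Continuity of the measure along half-lines whose intersection is empty. *)
Lemma gaussQ_small (e : R) : 0 < e -> exists2 a, 0 < a & gaussQ a < e.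
Proof.
move=> e0.
have : gauss (`[n%:R, +oo[%classic) @[n --> \oo] --> gauss (\bigcap_n `[n%:R, +oo[%classic).
  apply: (@nonincreasing_cvg_mu _ _ _ gauss (fun n : nat => `[n%:R, +oo[%classic)) => //.
  - by rewrite (le_lt_trans (probability_le1 _ _))// ltry.
  - by apply: bigcap_measurable => //.
  - move=> i j ij; apply/subsetPset => u /=; rewrite !in_itv/= !andbT.
    by apply: le_trans; rewrite ler_nat.
have -> : (\bigcap_n `[n%:R, +oo[%classic) = set0 :> set R.
  apply/seteqP; split=> // u /(_ (Num.truncn u).+1 I) /=.
  by rewrite in_itv/= andbT leNgt truncnS_gt.
rewrite measure0 => /fine_cvgP[_] /cvgrPdist_lt /(_ _ e0)[N _ /(_ N.+1 (leqnSn _))].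
rewrite /= sub0r normrN -EFin_gaussQ/= ger0_norm ?gaussQ_ge0// => H.
by exists N.+1%:R.
Qed.


(** On [[x, x + h]] the exponent [u ^+ 2 / 2] moves by at most [h * (A + 1)]. *)
Lemma gaussQB_ratio x h A : 0 < h <= 1 -> `|x| <= A ->
  let g := normal_peak 1 * h * expR (- (x ^+ 2 / 2)) in
  g * expR (- (h * (A + 1))) <= gaussQ x - gaussQ (x + h) <=
  g * expR (h * (A + 1)).
Proof.
move=> /andP[h0 h1]; rewrite ler_norml => /andP[xA1 xA2]; set g := (X in let g := X in _); move=> /=.
have xh : x < x + h by rewrite ltrDl.
pose c (e : R) := normal_peak 1 * expR (- (x ^+ 2 / 2)) * expR e.
have gE e : g * expR e = c e * (x + h - x) by rewrite /g /c; ring.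
rewrite !gE; apply: gaussQB_bounds => // u /andP[xu uxh].
rewrite normal_pdfE ?oner_eq0// /c -!mulrA !ler_pM2l ?normal_peak_gt0 ?oner_eq0//.
rewrite /normal_fun -!expRD !ler_expR subr0 expr1n.
by apply/andP; split; nra.
Qed.

Lemma gaussQ_decr x y : x < y -> gaussQ y < gaussQ x.
Proof.
move=> xy; rewrite -subr_gt0.
(* [x ^+ 2 + y ^+ 2] bounds [u ^+ 2] on the whole interval, whatever the signs of [x] and [y]. *)
pose lo : R := normal_peak 1 * expR (- ((x ^+ 2 + y ^+ 2) / 2)).
have lo0 : 0 < lo by rewrite mulr_gt0 ?normal_peak_gt0 ?oner_eq0 ?expR_gt0.
have /andP[+ _] : lo * (y - x) <= gaussQ x - gaussQ y <= normal_peak 1 * (y - x).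
  apply: gaussQB_bounds => // u /andP[xu uy]; rewrite normal_pdf_ub ?oner_eq0// andbT.
  rewrite normal_pdfE ?oner_eq0// ler_pM2l ?normal_peak_gt0 ?oner_eq0//.
  rewrite /normal_fun ler_expR subr0 expr1n.
  have [u0|u0] := leP 0 u; nra.
by apply: lt_le_trans; rewrite mulr_gt0 ?subr_gt0.
Qed.

Lemma continuous_gaussQ : continuous (@gaussQ R).
Proof.
pose c : R := normal_peak 1.
have c0 : 0 < c by rewrite normal_peak_gt0 ?oner_eq0.
have lip x y : x < y -> 0 <= gaussQ x - gaussQ y <= c * (y - x).
  move=> xy; rewrite -[X in X <= _](mul0r (y - x)).
  by apply: gaussQB_bounds => // u _; rewrite normal_pdf_ge0 normal_pdf_ub ?oner_eq0.
have lip' x y : `|gaussQ x - gaussQ y| <= c * `|x - y|.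
  have [xy|xy|->] := ltgtP x y; last by rewrite !subrr !normr0 mulr0.
  - by have /andP[l0 lc] := lip _ _ xy; rewrite ger0_norm// distrC gtr0_norm ?subr_gt0.
  - by have /andP[l0 lc] := lip _ _ xy; rewrite distrC ger0_norm// gtr0_norm ?subr_gt0.
move=> x; apply/cvgrPdist_lt => e e0; near=> y.
rewrite (le_lt_trans (lip' _ _))// mulrC -ltr_pdivlMr//.
near: y; apply/nbhs_ballP; exists (e / c) => //=; exact: divr_gt0.
Unshelve. all: by end_near. Qed.

Lemma gaussQ0 : gaussQ 0 = 1 / 2 :> R.
Proof. by have := gaussQN 0; rewrite oppr0; lra. Qed.

(** Intermediate values between [gaussQ 0 = 1 / 2] and a small tail give a preimage, so [xget] does
    not fall back on its default. *)
Lemma gaussQ_invP y : 0 < y < 1 / 2 ->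
  gaussQ (gaussQ_inv y) = y /\ 0 < gaussQ_inv y :> R.
Proof.
move=> /andP[y0 y2].
have [a a0 ay] := gaussQ_small y0.
have [x _ xy] : exists2 x, x \in `[0, a] & gaussQ x = y.
  apply: IVT; first exact: ltW.
    exact/continuous_subspaceT/continuous_gaussQ.
  by rewrite gaussQ0 ge_min le_max (ltW ay) orbT (ltW y2).
have Q : gaussQ (gaussQ_inv y) = y by rewrite /gaussQ_inv; case: xgetP => [z _ //|/(_ x)].
split => //; rewrite ltNge; apply/negP; rewrite le_eqVlt => /predU1P[z|/gaussQ_decr].
  by move: Q; rewrite z gaussQ0; lra.
by rewrite Q gaussQ0; lra.
Qed.

End GaussianTail.

(** * Product laws on binary words *)

Definition bit n (x : word n) (i : 'I_n) : bool := x 0 i != 0.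

Lemma F2_cases (u : 'F_2) : u = 0 \/ u = 1.
Proof. by case: u => -[|[|//]] ?; [left|right]; exact: val_inj. Qed.

Lemma bitD n (x y : word n) i : bit (x + y) i = bit x i (+) bit y i.
Proof.
rewrite /bit mxE.
by case: (F2_cases (x 0 i)) => ->; case: (F2_cases (y 0 i)) => ->.
Qed.

Lemma bitB n (x y : word n) i : bit (x - y) i = bit x i (+) bit y i.
Proof.
rewrite /bit !mxE.
by case: (F2_cases (x 0 i)) => ->; case: (F2_cases (y 0 i)) => ->.
Qed.

Lemma bit0 n i : bit (0 : word n) i = false.
Proof. by rewrite /bit mxE eqxx. Qed.

Definition word_of n (f : 'I_n -> bool) : word n := \row_i (f i)%:R.

Lemma word_ofK n (f : 'I_n -> bool) : bit (word_of f) =1 f.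
Proof. by move=> i; rewrite /bit mxE; case: (f i). Qed.

Lemma bitK n (x : word n) : word_of (bit x) = x.
Proof.
apply/rowP => i; rewrite mxE /bit.
by case: (F2_cases (x 0 i)) => ->; rewrite ?eqxx ?oner_eq0.
Qed.

Lemma wtHE n (x : word n) : wtH x = \sum_i (bit x i : nat).
Proof. rewrite /wtH -sum1_card big_mkcond; by apply: eq_bigr => i _; rewrite inE /bit; case: (_ != _). Qed.

Section ProductLaw.
Context {R : realType} {n : nat}.
Implicit Types (a c : 'I_n -> R) (x z : word n).

(** Independence of the bits: distributivity, after identifying words with boolean functions on the
    indices. *)
Lemma sum_word_prod (F : 'I_n -> bool -> R) :
  \sum_(z : word n) \prod_i F i (bit z i) = \prod_i (F i true + F i false).
Proof.
under [RHS]eq_bigr => i _ do rewrite -(big_bool _ (F i)).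
rewrite bigA_distr_bigA/= (reindex (fun f : {ffun 'I_n -> bool} => word_of f)).
  by apply: eq_bigr => f _; apply: eq_bigr => i _; rewrite word_ofK.
exists (fun x : word n => [ffun i => bit x i]) => [f _|x _].
  by apply/ffunP => i; rewrite ffunE word_ofK.
by rewrite -[RHS]bitK; congr word_of; apply/funext => i; rewrite ffunE.
Qed.

(** Independent bits with unequal parameters: after noise and jamming, the parameter of a coordinate
    depends on the codeword bit there. *)
Definition prodw a z : R := \prod_i (if bit z i then a i else 1 - a i).

Lemma prodw_ge0 a z : (forall i, 0 <= a i <= 1) -> 0 <= prodw a z.
Proof.
move=> a01; apply: prodr_ge0 => i _; have /andP[? ?] := a01 i.
by case: ifP => // _; rewrite subr_ge0.
Qed.

Lemma sum_prodw a : \sum_z prodw a z = 1.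
Proof.
rewrite (sum_word_prod (fun i b => if b then a i else 1 - a i)).
by rewrite big1// => i _; rewrite addrC subrK.
Qed.

Lemma prodwB a z x :
  prodw a (z - x) = prodw (fun i => if bit x i then 1 - a i else a i) z.
Proof.
apply: eq_bigr => i _; rewrite bitB.
by case: (bit z i); case: (bit x i) => //=; rewrite opprB addrC subrK.
Qed.

Lemma bern_wordB (q : R) z x :
  bern_word q (z - x) = prodw (fun i => if bit x i then 1 - q else q) z.
Proof. exact: prodwB. Qed.

(** Independent centred bits are uncorrelated, so only the diagonal of the expanded square
    survives. *)
Lemma prodw_variance a c :
  \sum_z prodw a z * (\sum_i c i * ((bit z i)%:R - a i)) ^+ 2 =
  \sum_i c i ^+ 2 * (a i * (1 - a i)).
Proof.
pose d i (b : bool) : R := b%:R - a i.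
have cov i j : \sum_z prodw a z * (d i (bit z i) * d j (bit z j)) =
    if i == j then a i * (1 - a i) else 0.
  (* Spreading the two deviations over the coordinates makes the sum factor; for [i != j] it
     vanishes because a centred bit has mean zero. *)
  pose F (k : 'I_n) (b : bool) : R := (if b then a k else 1 - a k) *
    ((if k == i then d k b else 1) * (if k == j then d k b else 1)).
  rewrite (eq_bigr (fun z => \prod_k F k (bit z k))); last first.
    move=> z _; rewrite /F !big_split/= -!big_mkcond/=. rewrite !big_pred1_eq.
    by [].
  rewrite sum_word_prod /F {F}; have [<-|ij] := eqVneq i j.
    rewrite (bigD1 i)//= eqxx big1 ?mulr1; first by rewrite /d /=; ring.
    by move=> k /negPf ->; rewrite !mulr1 addrC subrK.
  by rewrite (bigD1 i)//= eqxx (negPf ij) /d/=; ring.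
under eq_bigr => z _ do rewrite expr2 big_distrlr/= mulr_sumr.
rewrite exchange_big/=; apply: eq_bigr => i _.
under eq_bigr => z _ do rewrite mulr_sumr.
rewrite exchange_big/= (bigD1 i)//= [X in _ + X]big1 ?addr0.
  have := cov i i; rewrite eqxx => <-; rewrite mulr_sumr.
  by apply: eq_bigr => z _; rewrite /d; ring.
move=> j ji; have := cov i j; rewrite eq_sym (negPf ji) => /(congr1 ( *%R (c i * c j))).
rewrite mulr0 mulr_sumr => E; rewrite -[RHS]E.
by apply: eq_bigr => z _; rewrite /d; ring.
Qed.

(** Markov's inequality for the square. With suitable weights [c] it provides every concentration
    estimate below. *)
Lemma prodw_chebyshev a c (t : R) : (forall i, 0 <= a i <= 1) -> 0 < t ->
  \sum_(z | t <= `|\sum_i c i * ((bit z i)%:R - a i)|) prodw a z <=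
  (\sum_i c i ^+ 2 * (a i * (1 - a i))) / t ^+ 2.
Proof.
move=> a01 t0; rewrite ler_pdivlMr ?exprn_gt0// -prodw_variance mulr_suml.
rewrite [leRHS](bigID (fun z => t <= `|\sum_i c i * ((bit z i)%:R - a i)|))/=.
rewrite ler_wpDr//.
  by apply: sumr_ge0 => z _; rewrite mulr_ge0 ?prodw_ge0 ?sqr_ge0.
apply: ler_sum => z tz; rewrite ler_wpM2l ?prodw_ge0//.
by rewrite -[leRHS]real_normK ?num_real// lerXn2r ?nnegrE// ltW.
Qed.

Definition binom_law (q : R) (k : nat) : R :=
  'C(n, k)%:R * (q ^+ k * (1 - q) ^+ (n - k)).

Lemma wtH_le x : (wtH x <= n)%N.
Proof. by have := max_card [pred i | x 0 i != 0]; rewrite card_ord. Qed.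

Lemma prodw_cst (q : R) z :
  prodw (fun=> q) z = q ^+ wtH z * (1 - q) ^+ (n - wtH z).
Proof.
rewrite /prodw (bigID (bit z))/= (eq_bigr (fun=> q)); last by move=> i ->.
rewrite (@eq_bigr _ _ _ _ _ (fun i => ~~ bit z i) _ (fun=> 1 - q)); last first.
  by move=> i /negPf ->.
rewrite !prodr_const; congr (_ * _ ^+ _).
have nE := cardC (bit z); rewrite card_ord in nE.
have -> : #|(fun i => ~~ bit z i)| = (n - wtH z)%N by apply/eqP; rewrite -(eqn_add2l (wtH z)) subnKC ?max_card ?wtH_le//; exact/eqP.
by [].
Qed.

Lemma card_wtH k : #|[set z : word n | wtH z == k]%SET| = 'C(n, k).
Proof.
rewrite -[n in 'C(n, k)]card_ord -card_draws.
pose f (A : {set 'I_n}) : word n := word_of (fun i => i \in A).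
have finj : injective f.
  move=> A B fAB; apply/setP => i.
  by rewrite -(word_ofK (fun i => i \in A)) -/(f A) fAB word_ofK.
rewrite -(card_imset _ finj); apply: eq_card => z; rewrite inE.
apply/idP/imsetP => [/eqP zk|[A + ->]]; last first.
  rewrite inE => /eqP <-; apply/eqP; apply: eq_card => i.
  by rewrite inE -/(bit _ _) word_ofK.
exists [set i | bit z i]%SET; first by rewrite inE -zk; apply/eqP/eq_card => i; rewrite !inE.
by rewrite -[LHS]bitK; congr word_of; apply/funext => i; rewrite inE.
Qed.

Lemma sum_wtH (q : R) (P : pred nat) :
  \sum_(z : word n | P (wtH z)) prodw (fun=> q) z =
  \sum_(k < n.+1 | P k) binom_law q k.
Proof.
rewrite (partition_big (fun z => inord (wtH z) : 'I_n.+1) P)/=; last first.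
  by move=> z; rewrite inordK// ltnS wtH_le.
apply: eq_bigr => k Pk.
rewrite (eq_bigl (fun z => z \in [set z : word n | wtH z == k]%SET)); last first.
  move=> z; rewrite inE; apply/andP/eqP => [[_ /eqP/(congr1 val)]|zk].
    by rewrite /= inordK// ltnS wtH_le.
  by rewrite zk Pk; split => //; apply/eqP/val_inj; rewrite /= inordK.
rewrite (eq_bigr (fun=> q ^+ k * (1 - q) ^+ (n - k))); last first.
  by move=> z; rewrite inE prodw_cst => /eqP ->.
by rewrite sumr_const card_wtH -mulr_natl.
Qed.

End ProductLaw.

(** * The central limit theorem for binomial laws *)

Section ElementaryBounds.
Context {R : realType}.

(** The bound [ln (1 + x) <= x] applied to the reciprocal gives [t / (1 + t) <= ln (1 + t)]. *)
Lemma ln1D_lower (t : R) : - (1 / 2) <= t -> t - 2 * t ^+ 2 <= ln (1 + t).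
Proof.
move=> t2; have t1 : 0 < 1 + t by lra.
have H : ln ((1 + t)^-1) <= - (t / (1 + t)).
  rewrite [X in ln X](_ : _ = 1 + - (t / (1 + t))); last by field; rewrite ?lt0r_neq0//.
  by apply: le_ln1Dx; rewrite ltrN2 ltr_pdivrMr//; lra.
rewrite lnV ?posrE// in H.
have : t - 2 * t ^+ 2 <= t / (1 + t) by rewrite ler_pdivlMr//; nra.
lra.
Qed.

(** Requirements that [n] be large are phrased as lower bounds on its square root, so that several
    can be added into one constant. *)
Lemma exists_nat_sqrt (c : R) : exists N, forall n, (N <= n)%N -> c <= Num.sqrt n%:R.
Proof.
exists (Num.truncn (c ^+ 2)).+1 => n Nn; have [c0|c0] := leP c 0.
  by rewrite (le_trans c0).
rewrite -(ger0_norm (ltW c0)) -sqrtr_sqr ler_sqrt// ltW//.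
by rewrite (lt_le_trans (truncnS_gt _))// ler_nat.
Qed.

End ElementaryBounds.

Definition binom_sd {R : realType} (q : R) n : R :=
  Num.sqrt (q * (1 - q)) * Num.sqrt n%:R.

Definition binom_std {R : realType} (q : R) n k : R :=
  (k%:R - n%:R * q) / binom_sd q n.

(** * Ratios of consecutive binomial weights *)

Section BinomialRatio.
Context {R : realType} (q : R) (q01 : 0 < q < 1).
Implicit Types (n k : nat) (a A e : R).

Let sd : R := Num.sqrt (q * (1 - q)).
Let q0 : 0 < q. Proof. by have /andP[] := q01. Qed.
Let q1 : 0 < 1 - q. Proof. by rewrite subr_gt0; have /andP[] := q01. Qed.
Let sd0 : 0 < sd. Proof. by rewrite sqrtr_gt0 mulr_gt0. Qed.
Let sd2 : sd ^+ 2 = q * (1 - q). Proof. by rewrite sqr_sqrtr// ltW// mulr_gt0. Qed.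

(** Stated without division, in the form that [binom_ratio_step] takes as hypothesis. *)
Lemma binom_lawS n k : (k < n)%N ->
  binom_law (n := n) q k.+1 * (k.+1%:R * (1 - q)) = binom_law (n := n) q k * ((n%:R - k%:R) * q).
Proof.
move=> kn; rewrite /binom_law.
have E : k.+1%:R * 'C(n, k.+1)%:R = (n%:R - k%:R) * 'C(n, k)%:R :> R.
  by rewrite -natrB ?(ltnW kn)// -!natrM mul_bin_left.
rewrite (_ : (n - k)%N = (n - k.+1).+1); last by rewrite subnSK.
rewrite !exprS.
transitivity (k.+1%:R * 'C(n, k.+1)%:R * (q * q ^+ k * ((1 - q) * (1 - q) ^+ (n - k.+1)))); first by ring.
by rewrite E; ring.
Qed.

Lemma binom_law_gt0 n k : (k <= n)%N -> 0 < binom_law (n := n) q k.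
Proof. by move=> kn; rewrite mulr_gt0 ?ltr0n ?bin_gt0// mulr_gt0 ?exprn_gt0. Qed.

Let h n : R := (binom_sd q n)^-1.
Let x n k : R := binom_std q n k.

Lemma binom_sd_gt0 n : (0 < n)%N -> 0 < binom_sd q n.
Proof. by move=> n0; rewrite mulr_gt0// sqrtr_gt0 ltr0n. Qed.

Lemma binom_stdS n k : binom_std q n k.+1 = binom_std q n k + (binom_sd q n)^-1.
Proof. by rewrite /binom_std -natr1; ring. Qed.

(** The Gaussian factor cancels the first-order part of the logarithm of the ratio, leaving an error
    of order [1 / n]. The window [|x_k| <= A] holds of the order of [sqrt n] steps, so the
    accumulated error vanishes. *)
Lemma binom_ratio_step A : 0 < A -> exists2 C, 0 < C & exists N, forall n k (b0 b1 : R),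
  (N <= n)%N -> 0 < b0 ->
  b1 * (k.+1%:R * (1 - q)) = b0 * ((n%:R - k%:R) * q) -> `|binom_std q n k| <= A ->
  expR (- (C / n%:R)) * (b0 * expR (binom_std q n k ^+ 2 / 2)) <=
    b1 * expR (binom_std q n k.+1 ^+ 2 / 2) <=
  expR (C / n%:R) * (b0 * expR (binom_std q n k ^+ 2 / 2)).
Proof.
move=> A0.
pose C1 := A * sd + 1.
(* The first two terms bound what the first-order cancellation leaves; the last two bound the
   quadratic errors of the logarithms at [u] and [v]. *)
pose C : R := q^-1 + sd ^- 2 + 2 * (C1 / (1 - q)) ^+ 2 + 2 * (C1 / q) ^+ 2.
have C10 : 0 < C1 by rewrite addr_gt0 ?mulr_gt0.
have C0 : 0 < C.
  by rewrite !addr_gt0 ?invr_gt0 ?exprn_gt0 ?mulr_gt0 ?exprn_gt0 ?invr_gt0 ?mulr_gt0 ?divr_gt0.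
exists C => //.
(* Ensures [|u|, |v| <= 1 / 2], where [ln1D_lower] applies. *)
have [N HN] := exists_nat_sqrt (2 * (C1 / q + C1 / (1 - q)) + 1).
exists N => n k b0 b1 Nn b00 bE; rewrite -/(x n k) -/(x n k.+1) => xA.
set sn := Num.sqrt (n%:R : R).
have sn1 : 1 <= sn.
  rewrite (le_trans _ (HN n Nn))// lerDr.
  by rewrite mulr_ge0// addr_ge0 ?divr_ge0// ltW.
have sn0 : 0 < sn by lra.
have nsn : n%:R = sn ^+ 2 :> R by rewrite sqr_sqrtr.
have n0 : 0 < n%:R :> R by rewrite nsn exprn_gt0.
set y := k%:R - n%:R * q.
have hE : h n = (sd * sn)^-1 by [].
have yle : `|y| <= A * sd * sn.
  move: xA; rewrite /x /binom_std -/y -/(h n) hE normrM normfV (@gtr0_norm _ (sd * sn)) ?mulr_gt0//.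
  by rewrite ler_pdivrMr ?mulr_gt0// mulrA.
pose u := y / (n%:R * (1 - q)).
pose v := (y + 1) / (n%:R * q).
have ub : `|u| <= C1 / (1 - q) / sn.
  rewrite /u normrM normfV (@gtr0_norm _ (n%:R * (1 - q))) ?mulr_gt0//.
  rewrite ler_pdivrMr ?mulr_gt0//.
  have -> : C1 / (1 - q) / sn * (n%:R * (1 - q)) = C1 * sn by rewrite nsn; field; rewrite ?lt0r_neq0//.
  rewrite (le_trans yle)// ler_pM2r// /C1; lra.
have vb : `|v| <= C1 / q / sn.
  rewrite /v normrM normfV (@gtr0_norm _ (n%:R * q)) ?mulr_gt0//.
  rewrite ler_pdivrMr ?mulr_gt0//.
  have -> : C1 / q / sn * (n%:R * q) = C1 * sn by rewrite nsn; field; rewrite ?lt0r_neq0//.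
  rewrite (le_trans (ler_normD _ _))// normr1 /C1 mulrDl mul1r; lra.
have snb := HN n Nn; rewrite -/sn in snb.
have cq1 : 0 < C1 / q by rewrite divr_gt0.
have cq2 : 0 < C1 / (1 - q) by rewrite divr_gt0.
have u2 : `|u| <= 1 / 2 by rewrite (le_trans ub)// ler_pdivrMr//; lra.
have v2 : `|v| <= 1 / 2 by rewrite (le_trans vb)// ler_pdivrMr//; lra.
have sqb (w c : R) : 0 < c -> `|w| <= c / sn -> 2 * w ^+ 2 <= 2 * c ^+ 2 / n%:R.
  move=> c0 wc; rewrite -mulrA ler_pM2l//.
  rewrite -(real_normK (num_real w)) nsn -expr_div_n lerXn2r// nnegrE divr_ge0// ltW//.
have uu := sqb _ _ cq2 ub; have vv := sqb _ _ cq1 vb.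
have [u1 u1'] : - (1/2) <= - u /\ - 1 < v.
  by move: u2 v2; rewrite !ler_norml => /andP[? ?] /andP[? ?]; split; lra.
have [v1 v1'] : - (1/2) <= v /\ -1 < - u.
  by move: u2 v2; rewrite !ler_norml => /andP[? ?] /andP[? ?]; split; lra.
(* Logarithm of the quotient of the two compensated weights, since [b1 / b0 = (1 - u) / (1 + v)]. *)
pose D := ln (1 - u) - ln (1 + v) + x n k * h n + h n ^+ 2 / 2.
have hh : h n ^+ 2 = (n%:R * (q * (1 - q)))^-1.
  by rewrite hE exprVn exprMn sd2 -nsn mulrC.
have Dle : - (C / n%:R) <= D <= C / n%:R.
  have xh : x n k * h n = y * h n ^+ 2 by rewrite /x /binom_std -/y -/(h n); ring.
  have uv : - u - v + x n k * h n + h n ^+ 2 / 2 = sd ^- 2 / n%:R / 2 - q^-1 / n%:R.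
    by rewrite xh hh /u /v sd2; field; rewrite ?lt0r_neq0//.
  have L1 := ln1D_lower u1; have L2 := le_ln1Dx v1'.
  have L3 := ln1D_lower v1; have L4 := le_ln1Dx u1'.
  rewrite sqrrN in L1.
  have CE : C / n%:R = q^-1 / n%:R + sd ^- 2 / n%:R + 2 * (C1 / (1 - q)) ^+ 2 / n%:R + 2 * (C1 / q) ^+ 2 / n%:R.
    by rewrite /C !mulrDl.
  have p1 : 0 < q^-1 / n%:R by rewrite divr_gt0 ?invr_gt0.
  have p2 : 0 < sd ^- 2 / n%:R by rewrite divr_gt0 ?invr_gt0 ?exprn_gt0.
  have p3 : 0 <= 2 * u ^+ 2 by rewrite mulr_ge0 ?sqr_ge0.
  have p4 : 0 <= 2 * v ^+ 2 by rewrite mulr_ge0 ?sqr_ge0.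
  have L4' : ln (1 - u) <= - u by [].
  have L2' : ln (1 + v) <= v by apply: le_ln1Dx.
  rewrite CE /D; apply/andP; split; lra.
have rhoE : b1 * expR (x n k.+1 ^+ 2 / 2) = expR D * (b0 * expR (x n k ^+ 2 / 2)).
  have u0 : 0 < 1 - u by lra.
  have v0 : 0 < 1 + v by lra.
  have {}bE : b1 = b0 * ((1 - u) / (1 + v)).
    have K0 : 0 < k.+1%:R * (1 - q) by rewrite mulr_gt0.
    have uE : 1 - u = (n%:R - k%:R) / (n%:R * (1 - q)).
      by rewrite /u /y; field; rewrite ?lt0r_neq0//.
    have vE : 1 + v = k.+1%:R / (n%:R * q).
      by rewrite /v /y -natr1; field; rewrite ?lt0r_neq0//.
    have k10 : 0 < k%:R + 1 :> R by rewrite natr1.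
    have E : (n%:R - k%:R) * q = (1 - u) / (1 + v) * (k.+1%:R * (1 - q)).
      by rewrite uE vE -natr1; field; rewrite ?lt0r_neq0//.
    by move: bE; rewrite E [RHS]mulrA => /(mulIf (lt0r_neq0 K0)).
  have xx : x n k.+1 ^+ 2 / 2 = x n k ^+ 2 / 2 + (x n k * h n + h n ^+ 2 / 2).
    by rewrite /x binom_stdS -/(h n); field.
  have -> : D = (ln (1 - u) - ln (1 + v)) + (x n k * h n + h n ^+ 2 / 2) by rewrite /D addrA.
  rewrite xx bE !expRD expRN !lnK ?posrE//; ring.
have r0 : 0 < b0 * expR (x n k ^+ 2 / 2) by rewrite mulr_gt0 ?expR_gt0.
by rewrite rhoE !ler_pM2r// !ler_expR.
Qed.

End BinomialRatio.

(** * From weight ratios to the limit theorem *)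

Section DeMoivreLaplace.
Context {R : realType}.
Implicit Types (n k : nat) (q a A e : R).

(** The steps compound; convexity of [J] keeps every intermediate index where a step is
    controlled. *)
Lemma ratio_chain (rho : nat -> R) (J : pred nat) (c : R) :
  (forall k, J k -> J k.+1 ->
    expR (- c) * rho k <= rho k.+1 <= expR c * rho k) ->
  (forall k l m, (k <= l <= m)%N -> J k -> J m -> J l) ->
  forall d k, J k -> J (k + d)%N ->
    expR (- (d%:R * c)) * rho k <= rho (k + d)%N <= expR (d%:R * c) * rho k.
Proof.
move=> step cvx; elim=> [|d IH] k Jk Jkd.
  by rewrite addn0 mul0r oppr0 expR0 !mul1r lexx.
have Jd : J (k + d)%N by apply: cvx Jk Jkd; rewrite leq_addr leq_add2l leqnSn.
have /andP[l1 u1] := IH _ Jk Jd.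
rewrite addnS in Jkd *; have /andP[l2 u2] := step _ Jd Jkd.
rewrite -natr1 mulrDl mul1r opprD !expRD.
rewrite ![_ * expR c]mulrC ![_ * expR (- c)]mulrC -!mulrA; apply/andP; split.
  by apply: le_trans l2; rewrite ler_pM2l ?expR_gt0.
by apply: (le_trans u2); rewrite ler_pM2l ?expR_gt0.
Qed.

Lemma binom_chebyshev n q A : (0 < n)%N -> 0 < q < 1 -> 0 < A ->
  \sum_(k < n.+1 | A <= `|binom_std q n k|) binom_law (n := n) q k <= A ^- 2.
Proof.
move=> n0 q01 A0.
have [q0 q1] : 0 <= q /\ 0 <= 1 - q by move/andP: q01 => [? ?]; split; lra.
have s0 := binom_sd_gt0 q01 n0.
rewrite -(sum_wtH q (fun k => A <= `|binom_std q n k|)).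
have := @prodw_chebyshev R n (fun=> q) (fun=> 1) (A * binom_sd q n).
have -> : (\sum_(i < n) 1 ^+ 2 * (q * (1 - q))) / (A * binom_sd q n) ^+ 2 = A ^- 2.
  rewrite expr1n mul1r sumr_const card_ord -mulr_natl exprMn.
  have sE : binom_sd q n ^+ 2 = n%:R * (q * (1 - q)).
    by rewrite exprMn !sqr_sqrtr ?mulr_ge0// mulrC.
  by rewrite -sE; field; rewrite !lt0r_neq0.
move=> H; apply: le_trans (H _ _).
- rewrite le_eqVlt; apply/orP; left; apply/eqP; apply: eq_bigl => z.
  rewrite (_ : \sum_i _ = (wtH z)%:R - n%:R * q); last first.
    under eq_bigr do rewrite mul1r.
    by rewrite sumrB sumr_const card_ord wtHE natr_sum mulr_natl.
  by rewrite /binom_std normrM normfV (gtr0_norm s0) ler_pdivlMr.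
- by move=> i; move/andP: q01 => [? ?]; rewrite !ltW.
- by rewrite mulr_gt0.
Qed.

Lemma binom_std_mono q n k l : (k <= l)%N -> binom_std q n k <= binom_std q n l.
Proof.
by move=> kl; rewrite ler_wpM2r ?invr_ge0 ?mulr_ge0// lerB// ler_nat.
Qed.

(* No normalization is computed: on [|x_k| <= A] the ratio of the binomial weight
   to the Gaussian mass of [x_k, x_(k+1)] is nearly constant, so the share of
   [|x_k| < a] among [|x_k| <= A] is nearly the Gaussian one, and by Chebyshev
   [|x_k| <= A] carries binomial mass at least [1 - A ^- 2]. *)
Lemma de_moivre_laplace q a e : 0 < q < 1 -> 0 < a -> 0 < e ->
  exists N, forall n, (N <= n)%N ->
  1 - 2 * gaussQ a - e <=
  \sum_(k < n.+1 | `|binom_std q n k| < a) binom_law (n := n) q k.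
Proof.
move=> q01 a0 e0.
have [q0 q1] : 0 < q /\ 0 < 1 - q by move/andP: q01 => [? ?]; split; lra.
(* Large enough that Chebyshev discards mass at most [e / 2]. *)
pose A := a + 1 + 2 / e.
have e2 : 0 < 2 / e by rewrite divr_gt0.
have A0 : 0 < A by rewrite /A; lra.
have A1 : 1 <= A by rewrite /A; lra.
have aA : a <= A by rewrite /A; lra.
have A2 : A ^- 2 <= e / 2.
  rewrite -[e / 2]invrK lef_pV2 ?posrE ?exprn_gt0 ?invr_gt0 ?divr_gt0//.
  rewrite invf_div (@le_trans _ _ A)//; first by rewrite /A; lra.
  by rewrite expr2 ler_peMr// ltW.
have [C C0 [N1 HN1]] := binom_ratio_step q01 A0.
pose sd : R := Num.sqrt (q * (1 - q)).
have sd0 : 0 < sd by rewrite sqrtr_gt0 mulr_gt0.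
pose p : R := normal_peak 1.
have p0 : 0 < p by rewrite normal_peak_gt0 ?oner_eq0.
(* [K / sqrt n] is the total error [D + p * h] below. *)
pose K := 2 * A * sd * C + 2 * (A + 1) / sd + p / sd.
have K0 : 0 < K.
  by rewrite /K !addr_gt0 ?divr_gt0 ?mulr_gt0//; lra.
(* After the 1, the terms ensure in turn [h <= 1], [h <= a], [x 0 <= - a], [a <= x n] and a total
   error at most [e / 2]. *)
have [N2 HN2] := exists_nat_sqrt (1 + sd^-1 + (a * sd)^-1 + a * sd / q + a * sd / (1 - q) + K * (2 / e)).
exists (maxn N1 N2).+1 => n; rewrite ltn_neqAle => /andP[_]; rewrite geq_max => /andP[nN1 /HN2].
set sn := Num.sqrt (n%:R : R) => snK.
have c1 : 0 < sd^-1 by rewrite invr_gt0.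
have c5 : 0 < (a * sd)^-1 by rewrite invr_gt0 mulr_gt0.
have c2 : 0 < a * sd / q by rewrite divr_gt0 ?mulr_gt0.
have c3 : 0 < a * sd / (1 - q) by rewrite divr_gt0 ?mulr_gt0.
have c4 : 0 < K * (2 / e) by rewrite mulr_gt0.
have sn0 : 0 < sn by lra.
have nsn : n%:R = sn ^+ 2 :> R by rewrite sqr_sqrtr.
have n0 : (0 < n)%N by rewrite -(ltr0n R) nsn exprn_gt0.
have s0 := binom_sd_gt0 q01 n0.
set s := binom_sd q n in s0.
have sE : s = sd * sn by [].
set h := s^-1; have h0 : 0 < h by rewrite invr_gt0.
have h1 : h <= 1.
  rewrite invf_le1// sE -ler_pdivrMl// mulr1; lra.
set x := binom_std q n in HN1 *.
have xS k : x k.+1 = x k + h by rewrite /x binom_stdS.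
pose b k : R := binom_law (n := n) q k.
have b0 k : (k <= n)%N -> 0 < b k by move=> kn; exact: binom_law_gt0.
pose J k := (k <= n)%N && (`|x k| <= A).
have Jcvx k l m : (k <= l <= m)%N -> J k -> J m -> J l.
  move=> /andP[kl lm] /andP[_ xk] /andP[mn xm]; rewrite /J (leq_trans lm mn) /=.
  move: xk xm; rewrite !ler_norml => /andP[xk _] /andP[_ xm].
  by rewrite (le_trans xk) ?(le_trans _ xm) ?binom_std_mono.
(* Binomial weight over Gaussian density, up to a constant. *)
pose rho k := b k * expR (x k ^+ 2 / 2).
have rstep k : J k -> J k.+1 ->
    expR (- (C / n%:R)) * rho k <= rho k.+1 <= expR (C / n%:R) * rho k.
  move=> /andP[kn xk] /andP[kn1 xk1]; apply: HN1 => //; first exact: b0.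
  exact: binom_lawS.
(* Two indices of the window are at most [2 * A * s] apart, at a cost of [C / n] per step. *)
pose del := 2 * A * s * (C / n%:R).
have rho_le k l : J k -> J l -> rho k <= expR del * rho l.
  have Cn : 0 < C / n%:R by rewrite divr_gt0 ?ltr0n.
  have gap u d : J u -> J (u + d)%N -> d%:R * (C / n%:R) <= del.
    move=> /andP[_ xu] /andP[_ xd]; rewrite ler_pM2r//.
    have -> : d%:R = (x (u + d)%N - x u) * s.
      by rewrite /x /binom_std -/s natrD; field; rewrite lt0r_neq0.
    rewrite ler_pM2r//; move: xu xd; rewrite !ler_norml => /andP[? ?] /andP[? ?]; lra.
  have rho0 u : J u -> 0 < rho u.
    by move=> /andP[un _]; rewrite mulr_gt0 ?expR_gt0 ?b0.
  move=> Jk Jl; have [kl|/ltnW lk] := leqP k l.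
    move: Jl; rewrite -(subnKC kl) => Jl.
    have /andP[+ _] := ratio_chain rstep Jcvx Jk Jl.
    rewrite expRN mulrC ler_pdivrMr ?expR_gt0// => /le_trans; apply.
    by rewrite mulrC ler_pM2r ?rho0// ler_expR (gap _ _ Jk Jl).
  move: Jk; rewrite -(subnKC lk) => Jk.
  have /andP[_ +] := ratio_chain rstep Jcvx Jl Jk.
  move=> /le_trans; apply.
  by rewrite ler_pM2r ?rho0// ler_expR (gap _ _ Jl Jk).
pose G k := gaussQ (x k) - gaussQ (x k.+1).
pose g k := p * h * expR (- (x k ^+ 2 / 2)).
have G_bnd k : J k ->
    g k * expR (- (h * (A + 1))) <= G k <= g k * expR (h * (A + 1)).
  by move=> /andP[_ xk]; rewrite /G xS; apply: gaussQB_ratio; rewrite ?h0.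
have G0 k : 0 <= G k by rewrite subr_ge0 ltW// gaussQ_decr// xS ltrDl.
pose D := del + 2 * (h * (A + 1)).
(* The quotient [b / G] is constant up to [expR D]; the cross-multiplied form can be summed over [k]
   and [l]. *)
have bG k l : J k -> J l -> b k * G l <= expR D * (b l * G k).
  move=> Jk Jl; have /andP[Gk _] := G_bnd _ Jk; have /andP[_ Gl] := G_bnd _ Jl.
  have bE u : b u = rho u * expR (- (x u ^+ 2 / 2)).
    by rewrite /rho -mulrA -expRD subrr expR0 mulr1.
  have bl0 : 0 < b l by move/andP: Jl => [/b0].
  have bk0 : 0 < b k by move/andP: Jk => [/b0].
  rewrite (le_trans (_ : _ <= b k * (g l * expR (h * (A + 1)))))//.
    by rewrite ler_pM2l.
  rewrite (le_trans (_ : _ <= expR D * (b l * (g k * expR (- (h * (A + 1)))))))//; last first.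
    by rewrite ler_pM2l ?expR_gt0// ler_pM2l.
  rewrite /D mulrDl mul1r !expRD (bE k) (bE l) /g.
  set E := expR (h * _).
  have E1 : E * expR (- (h * (A + 1))) = 1 by rewrite -expRD subrr expR0.
  set F := expR (- (h * _)) in E1 *.
  have F0 : 0 < p * h * expR (- (x k ^+ 2 / 2)) * expR (- (x l ^+ 2 / 2)) * E.
    by rewrite !mulr_gt0 ?expR_gt0.
  rewrite [leLHS](_ : _ = rho k * (p * h * expR (- (x k ^+ 2 / 2)) * expR (- (x l ^+ 2 / 2)) * E)); last by ring.
  rewrite [leRHS](_ : _ = expR del * rho l * (p * h * expR (- (x k ^+ 2 / 2)) * expR (- (x l ^+ 2 / 2)) * E) * (E * F)); last by ring.
  by rewrite E1 mulr1 ler_pM2r// rho_le.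
pose I k := `|x k| < a.
have IJ (k : 'I_n.+1) : I k -> J k.
  by move=> /ltW Ik; rewrite /J -ltnS ltn_ord (le_trans Ik).
set SI := \sum_(k < n.+1 | _) _.
pose GI := \sum_(k < n.+1 | I k) G k.
have SJ : 1 - A ^- 2 <= \sum_(k < n.+1 | J k) b k.
  have := binom_chebyshev n0 q01 A0; rewrite -/x.
  move=> Cb; have S1 : \sum_(k < n.+1) b k = 1.
    by rewrite -(sum_prodw (fun _ : 'I_n => q)); exact/esym/(sum_wtH q predT).
  rewrite lerBlDr -S1 (bigID (fun k : 'I_n.+1 => J k))/= lerD2l.
  apply: le_trans Cb; rewrite big_mkcond [leRHS]big_mkcond/=.
  apply: ler_sum => k _; rewrite /J -ltnS ltn_ord/= -ltNge.
  case: ltP => [/ltW ->//|_].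
  have kb : 0 <= b k by apply/ltW/b0; rewrite -ltnS.
  by case: ifP.
have GJ : \sum_(k < n.+1 | J k) G k <= 1.
  apply: (@le_trans _ _ (\sum_(k < n.+1) G k)).
    by rewrite [leLHS]big_mkcond; apply: ler_sum => k _; case: ifP.
  rewrite -(big_mkord predT) (eq_bigr (fun k => - gaussQ (x k.+1) - - gaussQ (x k))); last first.
    by move=> k _; rewrite /G opprK addrC.
  rewrite telescope_sumr// opprK addrC.
  by have := gaussQ_le1 (x 0%N); have := gaussQ_ge0 (x n.+1); lra.
have GI_ge : 1 - 2 * gaussQ a - p * h <= GI.
  have ha : h <= a.
    rewrite /h sE -[leLHS]div1r ler_pdivrMr ?mulr_gt0// mulrA.
    by rewrite -ler_pdivrMl ?mulr_gt0// mulr1; lra.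
  (* Clipping to [h - a, a], which is covered by the intervals [x_k, x_(k+1)] with
     |x_k| < a, turns the restricted sum into a telescoping one. *)
  pose c (y : R) := Num.max (h - a) (Num.min y a).
  have c_lo y : y <= h - a -> c y = h - a.
    by move=> ya; rewrite /c max_l// ge_min ya.
  have c_hi y : a <= y -> c y = a.
    by move=> ya; rewrite /c min_r// max_r//; lra.
  have c_ge y : y <= a -> y <= c y.
    by move=> ya; rewrite /c min_l// le_max lexx orbT.
  have c_le y : h - a <= y -> c y <= y.
    by move=> ya; rewrite /c ge_max ya ge_min lexx.
  have Q_le y z : y <= z -> gaussQ z <= gaussQ y.
    by rewrite le_eqVlt => /predU1P[->//|/gaussQ_decr/ltW].
  pose G' k := gaussQ (c (x k)) - gaussQ (c (x k.+1)).
  have G'G k : G' k <= if I k then G k else 0.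
    rewrite /G' /G; case: ifPn => [|nI].
      rewrite /I ltr_norml => /andP[xk1 xk2].
      by apply: lerB; apply: Q_le; [exact/c_ge/ltW|apply: c_le; rewrite xS; lra].
    move: nI; rewrite /I -leNgt ler_normr => /orP[ax|ax].
      by rewrite !c_hi ?subrr// xS; lra.
    by rewrite !c_lo ?subrr// ?xS; lra.
  rewrite /GI big_mkcond/=.
  apply: (@le_trans _ _ (\sum_(k < n.+1) G' k)); last by apply: ler_sum => k _; exact: G'G.
  rewrite -(big_mkord predT) (eq_bigr (fun k => - gaussQ (c (x k.+1)) - - gaussQ (c (x k)))); last first.
    by move=> k _; rewrite /G' opprK addrC.
  rewrite telescope_sumr// opprK addrC.
  have nsE : n%:R / s = sn / sd by rewrite nsn sE; field; rewrite !lt0r_neq0.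
  have x0 : x 0%N <= - a.
    rewrite /x /binom_std -/s sub0r mulNr lerN2 mulrAC nsE.
    by rewrite mulrAC ler_pdivlMr// -ler_pdivrMr//; lra.
  have xn : a <= x n.
    rewrite /x /binom_std -/s (_ : _ / s = n%:R / s * (1 - q)); last by ring.
    by rewrite nsE mulrAC ler_pdivlMr// -ler_pdivrMr//; lra.
  rewrite (c_lo (x 0%N)); last by lra.
  rewrite (c_hi (x n.+1)); last by rewrite xS; lra.
  (* Clipping loses only the mass of [[- a, h - a]], at most [p * h]. *)
  have ah : - a < h - a by lra.
  have /andP[_ +] : 0 * (h - a - - a) <= gaussQ (- a) - gaussQ (h - a) <= p * (h - a - - a).
    by apply: gaussQB_bounds => // u _; rewrite normal_pdf_ge0 normal_pdf_ub ?oner_eq0.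
  rewrite gaussQN opprK subrK; lra.
have GI0 : 0 <= GI by apply: sumr_ge0.
have SI0 : 0 <= SI by apply: sumr_ge0 => k _; apply/ltW/b0; rewrite -ltnS.
(* Sum [bG] with its second index in the inner range and its first in the window, then use [SJ] and
   [GJ]. *)
have key : (1 - A ^- 2) * GI <= expR D * SI.
  apply: (@le_trans _ _ ((\sum_(k < n.+1 | J k) b k) * GI)); first by rewrite ler_wpM2r.
  apply: (@le_trans _ _ (expR D * (SI * \sum_(k < n.+1 | J k) G k))); last first.
    by rewrite ler_pM2l ?expR_gt0// ler_piMr.
  rewrite mulrC /GI /SI !big_distrlr/= mulr_sumr; apply: ler_sum => l Il.
  rewrite mulr_sumr; apply: ler_sum => k Jk.
  by rewrite mulrC; apply: bG => //; exact: IJ.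
have Dph : D + p * h <= e / 2.
  have -> : D + p * h = K / sn.
    by rewrite /D /del /K nsn /h sE; field; rewrite !lt0r_neq0.
  rewrite ler_pdivrMr// mulrC -ler_pdivrMr ?divr_gt0// invf_div; lra.
have ph0 : 0 < p * h by rewrite mulr_gt0.
have D0 : 0 <= D.
  by rewrite /D /del addr_ge0 ?mulr_ge0// ?ltW//; lra.
have [neg|pos] := leP (1 - 2 * gaussQ a - p * h) 0; first by lra.
have Al1 : A ^- 2 <= 1 by rewrite invf_le1 ?exprn_gt0// exprn_ege1.
have Ap : 0 < A ^- 2 by rewrite invr_gt0 exprn_gt0.
have eD : 1 - D <= expR (- D) by rewrite expR_ge1Dx.
have Q0 := gaussQ_ge0 a.
have : expR (- D) * ((1 - A ^- 2) * (1 - 2 * gaussQ a - p * h)) <= SI.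
  rewrite expRN mulrC ler_pdivrMr ?expR_gt0// (mulrC SI); apply: le_trans key.
  by rewrite ler_wpM2l// subr_ge0.
set y := 1 - 2 * gaussQ a - p * h in pos *.
have y1 : y <= 1 by rewrite /y; lra.
have zy : y - A ^- 2 <= (1 - A ^- 2) * y.
  by rewrite mulrBl mul1r lerB// ler_piMr// ltW.
have z0 : 0 <= (1 - A ^- 2) * y by apply: mulr_ge0; [rewrite subr_ge0|exact: ltW].
have z1 : (1 - A ^- 2) * y <= 1.
  by apply: mulr_ile1 => //; [rewrite subr_ge0|exact: ltW|rewrite gerBl ltW].
set z := (1 - A ^- 2) * y in zy z0 z1 *.
have : (1 - D) * z <= expR (- D) * z by rewrite ler_wpM2r.
have : D * z <= D by rewrite ler_piMr.
rewrite mulrBl mul1r; move: zy z0 z1 y1 pos; rewrite /y; lra.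
Qed.

End DeMoivreLaplace.

(** * Covertness forces light codewords *)

Section Covertness.
Context {R : realType}.
Implicit Types (q T a e : R).

Lemma card_word d : #|{: word d}| = (2 ^ d)%N.
Proof. by rewrite card_mx card_Fp// mul1n. Qed.

Lemma msg_prob_ge0 n d (C : Defs.code n d) b m : 0 <= msg_prob (C := C) R b m.
Proof. by rewrite /msg_prob; case: b => //; rewrite divr_ge0. Qed.

Lemma sum_msg_prob n d (C : Defs.code n d) b : \sum_m msg_prob (C := C) R b m = 1.
Proof.
rewrite big_ord_recl /msg_prob; case: b; last by rewrite eqxx big1 ?addr0.
rewrite eqxx mul0r add0r (eq_bigr (fun=> (nmsg C)%:R^-1)); last first.
  by move=> i _; rewrite mul1r.
by rewrite sumr_const card_ord -[LHS]mulr_natr mulVf// pnatr_eq0 -lt0n nmsg_gt0.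
Qed.

Lemma sum_key_prob d : \sum_(k : word d) (2 ^+ d)^-1 = 1 :> R.
Proof. by rewrite sumr_const card_word -[LHS]mulr_natr natrX mulVf// expf_neq0// pnatr_eq0. Qed.

Lemma sum_msg_key_prob n d (C : Defs.code n d) b :
  \sum_m \sum_(k : word d) msg_prob (C := C) R b m * (2 ^+ d)^-1 = 1.
Proof.
under eq_bigr => m _ do rewrite -mulr_sumr sum_key_prob mulr1.
exact: sum_msg_prob.
Qed.

Definition light_prob n d (C : Defs.code n d) T : R :=
  \sum_m \sum_(k | (wtH (enc C true m k))%:R <= T * Num.sqrt n%:R)
    msg_prob R true m * (2 ^+ d)^-1.

Lemma bern_word_ge0 n q (z : word n) : 0 <= q <= 1 -> 0 <= bern_word q z.
Proof. by move=> q01; exact: (@prodw_ge0 R n (fun=> q)). Qed.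

Lemma sum_bern_wordB n q (x : word n) : \sum_z bern_word q (z - x) = 1.
Proof. by under eq_bigr do rewrite bern_wordB; exact: sum_prodw. Qed.

(** The correction runs over the support of [x], so its fluctuation is governed by [wtH x] and not
    by [n]. *)
Lemma wtHD n (x s : word n) :
  (wtH (s + x))%:R = (wtH s)%:R + \sum_i (bit x i)%:R * (1 - 2 * (bit s i)%:R) :> R.
Proof.
rewrite !wtHE !natr_sum -big_split/=; apply: eq_bigr => i _.
by rewrite bitD; case: (bit s i); case: (bit x i) => /=; ring.
Qed.

(* The inner sum is the weight shift [wt (s + x) - wt s]; it concentrates
   around [(1 - 2 q) wt x] with a deviation of order [sqrt (wt x)]. *)
Lemma heavy_miss n (x : word n) q (eta c u : R) :
  0 < q < 1 -> 0 < eta -> (0 < wtH x)%N ->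
  c - (1 - 2 * q - eta) * (wtH x)%:R <= u ->
  \sum_(z | (wtH z)%:R < c) bern_word q (z - x) <=
  \sum_(z : word n | (wtH z)%:R <= u) prodw (fun=> q) z +
  (eta ^+ 2 * (wtH x)%:R)^-1.
Proof.
move=> q01 eta0 w0 cu; set w := (wtH x)%:R : R.
have q4 : 4 * (q * (1 - q)) <= 1 by have := sqr_ge0 (1 - 2 * q); lra.
have wpos : 0 < w by rewrite ltr0n.
have q01w : 0 <= q <= 1 by move/andP: q01 => [? ?]; rewrite !ltW.
rewrite (reindex_inj (addIr x))/=.
under eq_bigr => s _ do rewrite addrK.
pose c' i : R := -2 * (bit x i)%:R.
pose dev (s : word n) := \sum_i c' i * ((bit s i)%:R - q).
have wE : w = \sum_i (bit x i)%:R by rewrite /w wtHE natr_sum.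
have shift s : (wtH (s + x))%:R = (wtH s)%:R + (1 - 2 * q) * w + dev s.
  rewrite wtHD -addrA; congr (_ + _).
  by rewrite wE mulr_sumr -big_split/=; apply: eq_bigr => i _; rewrite /c'; ring.
have ch := @prodw_chebyshev R n (fun=> q) c' (eta * w) (fun=> q01w) (mulr_gt0 eta0 wpos).
have var : (\sum_i c' i ^+ 2 * (q * (1 - q))) / (eta * w) ^+ 2 <= (eta ^+ 2 * w)^-1.
  have -> : \sum_i c' i ^+ 2 * (q * (1 - q)) = 4 * (q * (1 - q)) * w.
    rewrite wE mulr_sumr; apply: eq_bigr => i _; rewrite /c'.
    by case: (bit x i) => /=; ring.
  rewrite ler_pdivrMr ?exprn_gt0 ?mulr_gt0//.
  rewrite (_ : _ * (eta * w) ^+ 2 = w); last by field; rewrite !lt0r_neq0.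
  by rewrite ler_piMl// ltW.
apply: le_trans (lerD (lexx _) (le_trans ch var)).
rewrite big_mkcond [X in _ <= X + _]big_mkcond [X in _ <= _ + X]big_mkcond -big_split/=.
apply: ler_sum => s _; rewrite -/(dev s).
have s0 : 0 <= prodw (fun _ : 'I_n => q) s by exact: prodw_ge0.
case: ifP => [sc|_]; last by rewrite addr_ge0//; case: ifP.
have -> : bern_word q s = prodw (fun=> q) s by [].
(* For [s] heavier than [u], a sum lighter than [c] forces the shift to miss its mean by more than
   [eta * w], an event counted by the second sum. *)
have [su|su] := leP (wtH s)%:R u; first by rewrite lerDl; case: ifP.
rewrite add0r; have [//|] := leP (eta * w); rewrite ltr_norml => /andP[d1 _].
by move: sc; rewrite shift; move: su cu d1; rewrite -/w; clear; lra.
Qed.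

(** The detector thresholds the weight at [c]. Light codewords are conceded as always missed; for
    the others the bound of [heavy_miss] is worst at weight [T * sqrt n]. *)
Lemma detection_le n d (C : Defs.code n d) q T (c u : R) (eta e : R) :
  0 < q < 1 -> 0 < eta -> 0 < T -> (0 < n)%N ->
  c - (1 - 2 * q - eta) * (T * Num.sqrt n%:R) <= u ->
  eta < 1 - 2 * q ->
  (eta ^+ 2 * (T * Num.sqrt n%:R))^-1 <= e ->
  min_detection C q <=
  \sum_(z : word n | c <= (wtH z)%:R) prodw (fun=> q) z +
  \sum_(z : word n | (wtH z)%:R <= u) prodw (fun=> q) z + e + light_prob C T.
Proof.
move=> q01 eta0 T0 n0 cu etaq ew.
have q01w : 0 <= q <= 1 by move/andP: q01 => [? ?]; rewrite !ltW.
set U := \sum_(z : word n | (wtH z)%:R <= u) _.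
have U0 : 0 <= U by apply: sumr_ge0 => z _; exact: prodw_ge0.
have w0 : 0 < T * Num.sqrt (n%:R : R) by rewrite mulr_gt0// sqrtr_gt0 ltr0n.
pose Phi := [ffun z : word n => c <= (wtH z)%:R].
have pge0 b m k z : 0 <= law_MKZ (C := C) q b m k z.
  by rewrite !mulr_ge0 ?msg_prob_ge0 ?invr_ge0 ?exprn_ge0// bern_word_ge0.
apply: (@le_trans _ _ (P_FA C q Phi + P_MD C q Phi)).
  apply: ge_inf; last by exists Phi.
  exists 0 => _ [f _ <-]; rewrite addr_ge0//;
    do 3![apply: sumr_ge0 => ? _]; exact: pge0.
rewrite -!addrA lerD//.
  (* In silence only the message 0 has mass, and it is encoded as the zero word. *)
  rewrite /P_FA big_ord_recl/= [X in _ + X]big1 ?addr0; last first.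
    by move=> i _; apply: big1 => k _; apply: big1 => z _; rewrite /law_MKZ /msg_prob/= !mul0r.
  rewrite /law_MKZ /msg_prob eqxx.
  under eq_bigr => k _.
    rewrite enc_silent -mulr_sumr mul1r.
    under eq_bigr => z _ do rewrite subr0.
    over.
  rewrite -mulr_suml sum_key_prob mul1r.
  rewrite le_eqVlt; apply/orP; left; apply/eqP; apply: eq_bigl => z.
  by rewrite ffunE eqb_id.
(* Averaging the constants over message and key allows a comparison codeword by codeword. *)
have -> : U + (e + light_prob C T) = \sum_m \sum_(k : word d) msg_prob (C := C) R true m * (2 ^+ d)^-1 * (U + e)
    + light_prob C T.
  under eq_bigr => m _ do rewrite -mulr_suml.
  by rewrite -mulr_suml sum_msg_key_prob mul1r addrA.
rewrite -big_split/=; apply: ler_sum => m _.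
rewrite [X in _ <= _ + X]big_mkcond -big_split/=; apply: ler_sum => k _.
set x := enc C true m k; set p0 := msg_prob R true m * (2 ^+ d)^-1.
have p00 : 0 <= p0 by rewrite mulr_ge0 ?msg_prob_ge0 ?invr_ge0 ?exprn_ge0.
rewrite /law_MKZ -/x -/p0 -mulr_sumr.
have e0 : 0 <= e by rewrite (le_trans _ ew)// invr_ge0 mulr_ge0 ?sqr_ge0// ltW.
rewrite (eq_bigl (fun z : word n => (wtH z)%:R < c)); last first.
  by move=> z; rewrite ffunE eqbF_neg -ltNge.
have [light|heavy] := leP (wtH x)%:R (T * Num.sqrt n%:R).
  rewrite ler_wpDl//; first by rewrite mulr_ge0// addr_ge0.
  rewrite ler_piMr//.
  rewrite -(sum_bern_wordB q x) big_mkcond/=; apply: ler_sum => z _.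
  by case: ifP => // _; exact: bern_word_ge0.
rewrite addr0 ler_wpM2l//.
have wx0 : 0 < (wtH x)%:R :> R by rewrite (lt_trans w0).
have cx : c - (1 - 2 * q - eta) * (wtH x)%:R <= u.
  by apply: le_trans cu; rewrite lerD2l lerN2 ler_pM2l ?subr_gt0// ltW.
have wx : (0 < wtH x)%N by rewrite -(ltr0n R).
apply: (le_trans (heavy_miss q01 eta0 wx cx)).
rewrite lerD2l (le_trans _ ew)// lef_pV2 ?posrE ?(mulr_gt0 _ w0) ?(mulr_gt0 _ wx0) ?exprn_gt0//.
by rewrite ler_pM2l ?exprn_gt0// ltW.
Qed.

(** With the threshold at [n q + a sd sqrt n], a weight shift of [2 a sd sqrt n] puts false alarms
    and misses in the two tails beyond [a] standard deviations. Covertness then bounds [light_prob]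
    from below. *)
Lemma covert_light q T a e : 0 < q < 1 -> 0 < a -> 0 < T -> 0 < e ->
  2 * (a * Num.sqrt (q * (1 - q))) < (1 - 2 * q) * T ->
  exists N, forall n d (C : Defs.code n d), (N <= n)%N ->
  min_detection C q <= 2 * gaussQ a + e + light_prob C T.
Proof.
move=> q01 a0 T0 e0 aT.
set sd := Num.sqrt _ in aT.
have sd0 : 0 < sd by rewrite sqrtr_gt0 mulr_gt0; move/andP: q01 => [? ?]; lra.
(* Uses up the slack in [aT]: [(1 - 2 * q - eta) * T] is exactly [2 * (a * sd)]. *)
pose eta := ((1 - 2 * q) * T - 2 * (a * sd)) / T.
have eta0 : 0 < eta by rewrite divr_gt0// subr_gt0.
have [N1 HN1] := de_moivre_laplace q01 a0 (divr_gt0 e0 (ltr0n R 2)).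
have [N2 HN2] := @exists_nat_sqrt R ((eta ^+ 2 * T)^-1 * (2 / e)).
exists (maxn 1 (maxn N1 N2)) => n d C; rewrite !geq_max => /and3P[n0 nN1 nN2].
have {}HN2 := HN2 _ nN2; have {}HN1 := HN1 _ nN1.
set sn := Num.sqrt (n%:R : R) in HN2.
have sn0 : 0 < sn by rewrite sqrtr_gt0 ltr0n.
have := @detection_le n d C q T (n%:R * q + a * sd * sn) (n%:R * q - a * sd * sn) eta (e / 2) q01 eta0 T0 n0.
rewrite -/sn => H; apply: le_trans (H _ _ _) _.
- have -> : (1 - 2 * q - eta) * (T * sn) = 2 * (a * sd) * sn.
    by rewrite /eta; field; rewrite lt0r_neq0.
  by rewrite le_eqVlt; apply/orP; left; apply/eqP; ring.
- by rewrite /eta ltr_pdivrMr// gtrBl !mulr_gt0.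
- rewrite mulrA invfM ler_pdivrMr// -ler_pdivrMl ?divr_gt0//.
  by rewrite invf_div mulrC.
rewrite lerD2r.
suff : \sum_(z : word n | n%:R * q + a * sd * sn <= (wtH z)%:R) prodw (fun=> q) z +
  \sum_(z : word n | (wtH z)%:R <= n%:R * q - a * sd * sn) prodw (fun=> q) z <= 2 * gaussQ a + e / 2 by lra.
rewrite -(sum_wtH q (fun k => `|binom_std q n k| < a)) in HN1.
have := sum_prodw (fun _ : 'I_n => q).
rewrite (bigID (fun z : word n => `|binom_std q n (wtH z)| < a))/=.
set S1 := \sum_(z | _) _ in HN1 *; set S2 := \sum_(z | ~~ _) _ => S12.
suff : \sum_(z : word n | n%:R * q + a * sd * sn <= (wtH z)%:R) prodw (fun=> q) z +
  \sum_(z : word n | (wtH z)%:R <= n%:R * q - a * sd * sn) prodw (fun=> q) z <= S2 by lra.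
(* The two tails are disjoint and lie outside the central range. *)
rewrite /S2 big_mkcond [X in _ + X]big_mkcond [leRHS]big_mkcond -big_split/=.
apply: ler_sum => z _.
have s0 := binom_sd_gt0 q01 n0.
have as0 : 0 < a * sd * sn by rewrite !mulr_gt0.
rewrite -leNgt /binom_std normrM normfV (gtr0_norm s0) ler_pdivlMr//.
rewrite /binom_sd -/sd -/sn mulrA ler_normr.
set w := (wtH z)%:R : R.
have z0 : 0 <= prodw (fun _ : 'I_n => q) z.
  by apply: prodw_ge0 => i; move/andP: q01 => [? ?]; rewrite !ltW.
have -> : (a * sd * sn <= w - n%:R * q) = (n%:R * q + a * sd * sn <= w) by rewrite lerBrDl.
have -> : (a * sd * sn <= - (w - n%:R * q)) = (w <= n%:R * q - a * sd * sn).
  by rewrite opprB lerBrDl addrC -lerBrDl.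
have : ~~ ((n%:R * q + a * sd * sn <= w) && (w <= n%:R * q - a * sd * sn)).
  by apply/negP => /andP[? ?]; lra.
by case: (_ <= w); case: (w <= _) => //= _; rewrite ?addr0 ?add0r.
Qed.

End Covertness.

(** * Jamming and the rate of light codewords *)

Section BinaryDivergence.
Context {R : realType}.
Implicit Types u v : R.

(** In natural units; [I_BE] divides by [ln 2]. *)
Definition binary_KL u v : R :=
  u * ln (u / v) + (1 - u) * ln ((1 - u) / (1 - v)).

(** Each term [s * ln (s / t)] is at least [s - t], and the two differences cancel. *)
Lemma binary_KL_ge0 u v : 0 < u < 1 -> 0 < v < 1 -> 0 <= binary_KL u v.
Proof.
move=> /andP[u0 u1] /andP[v0 v1]; rewrite /binary_KL.
have lnle (s t : R) : 0 < s -> 0 < t -> s - t <= s * ln (s / t).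
  move=> s0 t0; have : ln (1 + (t / s - 1)) <= t / s - 1.
    by apply: le_ln1Dx; rewrite ltrBrDl subrr divr_gt0.
  rewrite addrC subrK -[t / s]invf_div lnV ?posrE ?divr_gt0// => H.
  have -> : s - t = s * (1 - (s / t)^-1) by field; rewrite !lt0r_neq0.
  by rewrite ler_pM2l//; lra.
have := lnle _ _ u0 v0.
have u1' : 0 < 1 - u by lra.
have v1' : 0 < 1 - v by lra.
by have := lnle _ _ u1' v1'; lra.
Qed.

(* The log-likelihood ratio of the two product laws is a sum over the support of
   [x] with mean [wt x * KL]; it concentrates by Chebyshev. *)
Lemma change_of_measure u v T eta e : 0 < u < 1 -> 0 < v < 1 ->
  0 < T -> 0 < eta -> 0 < e ->
  exists N, forall n (x : word n) (P : pred (word n)), (N <= n)%N ->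
  (wtH x)%:R <= T * Num.sqrt n%:R ->
  \sum_(y | P y) prodw (fun i => if bit x i then u else v) y <=
  expR ((T * binary_KL u v + eta) * Num.sqrt n%:R) *
    \sum_(y : word n | P y) prodw (fun=> v) y + e.
Proof.
move=> u01 v01 T0 eta0 e0; have KL0 := binary_KL_ge0 u01 v01.
move: (u01) (v01) => /andP[u0 u1] /andP[v0 v1].
have u1' : 0 < 1 - u by lra.
have v1' : 0 < 1 - v by lra.
set l1 := ln (u / v); set l0 := ln ((1 - u) / (1 - v)).
have el1 : expR l1 = u / v by rewrite lnK// posrE divr_gt0.
have el0 : expR l0 = (1 - u) / (1 - v) by rewrite lnK// posrE divr_gt0.
pose L := (l1 - l0) ^+ 2.
have L0 : 0 <= L by exact: sqr_ge0.
(* The variance is of order [sqrt n] and the squared deviation of order [n]; this makes their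
   quotient at most [e]. *)
have [N HN] := @exists_nat_sqrt R (1 + T * L / (eta ^+ 2 * e)).
exists N => n x P /HN; set sn := Num.sqrt (n%:R : R) => snN wx.
have TL0 : 0 <= T * L / (eta ^+ 2 * e).
  apply: divr_ge0; apply: mulr_ge0 => //; [exact: ltW|exact: sqr_ge0|exact: ltW].
have sn0 : 0 < sn by lra.
pose al i := if bit x i then u else v.
have al01 i : 0 <= al i <= 1 by rewrite /al; case: ifP => _; apply/andP; split; exact: ltW.
pose c i : R := (l1 - l0) * (bit x i)%:R.
have wE : (wtH x)%:R = \sum_i (bit x i)%:R :> R by rewrite wtHE natr_sum.
have ch := prodw_chebyshev c al01 (mulr_gt0 eta0 sn0).
have var : (\sum_i c i ^+ 2 * (al i * (1 - al i))) / (eta * sn) ^+ 2 <= e.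
  have : \sum_i c i ^+ 2 * (al i * (1 - al i)) <= L * (T * sn).
    apply: (@le_trans _ _ (L * (wtH x)%:R)); last by rewrite ler_wpM2l.
    rewrite wE mulr_sumr; apply: ler_sum => i _.
    have alq : al i * (1 - al i) <= 1 by have := sqr_ge0 (1 - 2 * al i); lra.
    have -> : c i ^+ 2 = L * (bit x i)%:R.
      by rewrite /c /L; case: (bit x i) => /=; ring.
    by rewrite ler_piMr// mulr_ge0.
  move=> H; rewrite ler_pdivrMr ?exprn_gt0 ?mulr_gt0//; apply: (le_trans H).
  suff : T * L <= sn * (eta ^+ 2 * e).
    move=> /(ler_wpM2l (ltW sn0)); rewrite (_ : sn * (T * L) = L * (T * sn)); last by ring.
    by rewrite (_ : sn * (sn * _) = e * (eta * sn) ^+ 2)//; ring.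
  by rewrite -ler_pdivrMr ?mulr_gt0 ?exprn_gt0//; lra.
apply: le_trans (lerD (lexx _) (le_trans ch var)).
rewrite mulr_sumr big_mkcond [X in _ <= X + _]big_mkcond [X in _ <= _ + X]big_mkcond -big_split/=.
apply: ler_sum => y _.
have y0 : 0 <= prodw al y by exact: prodw_ge0.
have v0y : 0 <= prodw (fun _ : 'I_n => v) y by apply: prodw_ge0 => _; rewrite !ltW.
have [Py|_] := ifP; last by rewrite add0r; case: ifP.
have [dev|dev] := leP (eta * sn); first by rewrite lerDr mulr_ge0// expR_ge0.
rewrite addr0.
have -> : prodw al y = expR (\sum_i (bit x i)%:R * (l0 + (l1 - l0) * (bit y i)%:R)) *
    prodw (fun=> v) y.
  rewrite expR_sum -big_split/=; apply: eq_bigr => i _; rewrite /al.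
  case: (bit x i); last by rewrite mul0r expR0 mul1r.
  rewrite mul1r; case: (bit y i).
    by rewrite mulr1 addrC subrK el1; field; rewrite lt0r_neq0.
  by rewrite mulr0 addr0 el0; field; rewrite lt0r_neq0.
rewrite ler_wpM2r// ler_expR.
have -> : \sum_i (bit x i)%:R * (l0 + (l1 - l0) * (bit y i)%:R) =
    (wtH x)%:R * binary_KL u v + \sum_i c i * ((bit y i)%:R - al i).
  rewrite wE mulr_suml -big_split/=; apply: eq_bigr => i _.
  rewrite /c /al /binary_KL -/l1 -/l0; case: (bit x i) => /=; ring.
rewrite mulrDl lerD//; last by move: dev; rewrite ltr_norml => /andP[_ /ltW].
(* The divergence being non-negative, the weight may be replaced by its upper bound. *)
by rewrite mulrAC ler_wpM2r.
Qed.

End BinaryDivergence.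

(** * The thinning jammer *)

Section Jamming.
Context {R : realType}.
Implicit Types (p q th T e : R).

Definition thin th n (z s : word n) : R :=
  prodw (fun i => if bit z i then th else 0) s.

Lemma thin_ge0 th n (z s : word n) : 0 <= th <= 1 -> 0 <= thin th z s.
Proof. by move=> th01; apply: prodw_ge0 => i; case: ifP; rewrite ?lexx ?ler01. Qed.

(** Averaged over the noise, the jamming bits are independent given the codeword: the receiver sees
    a memoryless channel. *)
Lemma thin_marginal q th n (x s : word n) :
  \sum_z bern_word q (z - x) * thin th z s =
  prodw (fun i => th * (if bit x i then 1 - q else q)) s.
Proof.
under eq_bigr do rewrite bern_wordB -big_split/=.
pose F i b := (if b then if bit x i then 1 - q else q
    else 1 - (if bit x i then 1 - q else q)) *
  (if bit s i then if b then th else 0 else 1 - (if b then th else 0)).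
rewrite (sum_word_prod F); apply: eq_bigr => i _; rewrite /F.
by case: (bit s i); ring.
Qed.

(* The jammer copies each observed one with probability [th], and stays silent
   when the resulting word exceeds its weight budget. *)
Definition thin_jam p th n (z s : word n) : R :=
  if (wtH s)%:R <= p * n%:R then
    thin th z s +
    (s == 0)%:R * \sum_(t | ~~ ((wtH t)%:R <= p * n%:R)) thin th z t
  else 0.

Lemma wtH0 n : wtH (0 : word n) = 0%N.
Proof. by rewrite wtHE big1// => i _; rewrite bit0. Qed.

Lemma jamming_thin_jam p th n : 0 <= p -> 0 <= th <= 1 ->
  jamming p (@thin_jam p th n).
Proof.
move=> p0 th01; have w00 : (wtH (0 : word n))%:R <= p * n%:R by rewrite wtH0 mulr_ge0.
split.
- move=> z s; rewrite /thin_jam; case: ifP => // _.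
  rewrite addr_ge0 ?thin_ge0// mulr_ge0//; apply: sumr_ge0 => t _; exact: thin_ge0.
- move=> z; rewrite -big_mkcond/= big_split/= [X in _ + X](bigD1 (0 : word n))//= eqxx mul1r.
  rewrite [X in _ + (_ + X)]big1 ?addr0; last by move=> s /andP[_ /negPf ->]; rewrite mul0r.
  rewrite -[RHS](sum_prodw (fun i => if bit z i then th else 0)).
  by rewrite [RHS](bigID (fun s : word n => (wtH s)%:R <= p * n%:R)).
- by move=> z s; rewrite /thin_jam; case: ifP => //; rewrite eqxx.
Qed.

(** The mean weight is at most [n th q + wtH x], and a codeword weight of order [sqrt n] is
    negligible against the slack [n (p - th q)]. *)
Lemma thin_weight p q th T e : 0 <= q <= 1 -> 0 <= th <= 1 -> th * q < p ->
  0 < T -> 0 < e ->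
  exists N, forall n (x : word n), (N <= n)%N -> (wtH x)%:R <= T * Num.sqrt n%:R ->
  \sum_(s : word n | ~~ ((wtH s)%:R <= p * n%:R))
    prodw (fun i => th * (if bit x i then 1 - q else q)) s <= e.
Proof.
move=> /andP[q0 q1] /andP[th0 th1] thp T0 e0.
(* Half of the slack covers the codeword, the other half the random deviation. *)
pose dl := (p - th * q) / 2.
have dl0 : 0 < dl by rewrite /dl; lra.
have [N HN] := @exists_nat_sqrt R (1 + T / dl + (dl ^+ 2 * e)^-1).
exists N => n x /HN; set sn := Num.sqrt (n%:R : R) => snN wx.
have c1 : 0 < T / dl by rewrite divr_gt0.
have de0 : 0 < dl ^+ 2 * e by apply: mulr_gt0 => //; exact: exprn_gt0.
have c2 : 0 < (dl ^+ 2 * e)^-1 by rewrite invr_gt0.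
have sn1 : 1 <= sn by lra.
have sn0 : 0 < sn by lra.
have nsn : n%:R = sn ^+ 2 :> R by rewrite sqr_sqrtr.
pose al i := th * (if bit x i then 1 - q else q).
have al01 i : 0 <= al i <= 1.
  rewrite /al; case: (bit x i); apply/andP; split.
  - by rewrite mulr_ge0// subr_ge0.
  - by apply: mulr_ile1 => //; lra.
  - by rewrite mulr_ge0.
  - by apply: mulr_ile1.
have n0 : 0 < n%:R :> R by rewrite nsn exprn_gt0.
have ndl0 := mulr_gt0 n0 dl0.
have ch := prodw_chebyshev (fun=> 1) al01 ndl0.
have var : (\sum_i 1 ^+ 2 * (al i * (1 - al i))) / (n%:R * dl) ^+ 2 <= e.
  have : \sum_i 1 ^+ 2 * (al i * (1 - al i)) <= n%:R.
    rewrite -[n in leRHS]card_ord -sumr_const; apply: ler_sum => i _.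
    by have := sqr_ge0 (1 - 2 * al i); lra.
  move=> H; rewrite ler_pdivrMr ?exprn_gt0//; apply: (le_trans H).
  rewrite (_ : e * _ = n%:R * (n%:R * (dl ^+ 2 * e))); last by ring.
  apply: ler_peMr; first exact: ltW.
  rewrite -ler_pdivrMr// mul1r.
  rewrite nsn expr2; apply: (@le_trans _ _ sn); first by lra.
  by rewrite ler_peMr// ltW.
apply: le_trans (le_trans ch var).
rewrite big_mkcond [leRHS]big_mkcond/=; apply: ler_sum => s _.
have s0 : 0 <= prodw al s by exact: prodw_ge0.
rewrite -ltNge; case: ifP => [sw|_]; last by case: ifP.
suff -> : n%:R * dl <= `|\sum_i 1 * ((bit s i)%:R - al i)| by [].
rewrite (le_trans _ (ler_norm _))//.
under eq_bigr do rewrite mul1r.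
rewrite sumrB -natr_sum -wtHE.
have alle : \sum_i al i <= n%:R * (th * q) + (wtH x)%:R.
  have -> : n%:R * (th * q) = \sum_(i < n) th * q.
    by rewrite sumr_const card_ord mulr_natl.
  rewrite wtHE natr_sum -big_split/=.
  apply: ler_sum => i _; rewrite /al; case: (bit x i) => /=; last by rewrite addr0.
  have : th * (1 - q) <= 1 by apply: mulr_ile1 => //; lra.
  have : 0 <= th * q by exact: mulr_ge0.
  lra.
have : T * sn <= n%:R * dl.
  by rewrite nsn expr2 -mulrA mulrC ler_pM2l// -ler_pdivrMr//; lra.
have : n%:R * dl * 2 = p * n%:R - n%:R * (th * q) by rewrite /dl; field.
lra.
Qed.

End Jamming.

(** * Lower bound on the error probability *)

Section ErrorBound.
Context {R : realType}.
Implicit Types (p q th T e : R).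

Lemma law_MKZ_ge0 n d (C : Defs.code n d) q b m k z : 0 <= q <= 1 ->
  0 <= law_MKZ (C := C) q b m k z.
Proof.
by move=> q01; rewrite !mulr_ge0 ?msg_prob_ge0 ?invr_ge0 ?exprn_ge0// bern_word_ge0.
Qed.

Lemma err_prob_ge0 n d (C : Defs.code n d) p q W b : 0 <= q <= 1 -> jamming p W ->
  0 <= err_prob C q W b.
Proof.
move=> q01 [W0 _ _]; do 4![apply: sumr_ge0 => ? _].
by rewrite mulr_ge0// law_MKZ_ge0.
Qed.

Lemma err_prob_le1 n d (C : Defs.code n d) p q W b : 0 <= q <= 1 -> jamming p W ->
  err_prob C q W b <= 1.
Proof.
move=> q01 [W0 W1 _]; rewrite -(@sum_msg_key_prob R n d C b).
apply: ler_sum => m _; apply: ler_sum => k _.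
apply: (@le_trans _ _ (\sum_z law_MKZ (C := C) q b m k z)).
  apply: ler_sum => z _; rewrite -mulr_sumr ler_piMr ?law_MKZ_ge0//.
  rewrite -(W1 z) big_mkcond/=; apply: ler_sum => s _.
  by case: ifP.
by rewrite /law_MKZ -mulr_sumr sum_bern_wordB mulr1.
Qed.

(** Errors under silence are dropped. The supremum bounds its elements because each error
    probability is at most 1. *)
Lemma P_err_ge n d (C : Defs.code n d) p q W : 0 <= q <= 1 -> jamming p W ->
  err_prob C q W true <= P_err C p q.
Proof.
move=> q01 jW; apply: (@le_trans _ _ (err_prob C q W false + err_prob C q W true)).
  by rewrite lerDr; exact: err_prob_ge0 jW.
apply: sup_upper_bound; last by exists W.
split; first by exists (err_prob C q W false + err_prob C q W true), W.
exists (1 + 1) => _ [V jV <-].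
by rewrite lerD// (err_prob_le1 _ _ q01 jV).
Qed.

(* For each key the decoding regions partition the words. *)
Lemma sum_decode_le n d (C : Defs.code n d) (mu : word n -> R) :
  (forall y, 0 <= mu y) -> \sum_y mu y = 1 ->
  \sum_m \sum_k msg_prob (C := C) R true m * (2 ^+ d)^-1 *
    \sum_(y | dec C y k == m) mu y <= (nmsg C)%:R^-1.
Proof.
move=> mu0 mu1; rewrite exchange_big/=.
apply: (@le_trans _ _ (\sum_(k : word d) (2 ^+ d)^-1 * (nmsg C)%:R^-1)); last first.
  by rewrite -mulr_suml sum_key_prob mul1r.
apply: ler_sum => k _.
have E : \sum_m \sum_(y | dec C y k == m) mu y = 1.
  by rewrite -mu1 [RHS](partition_big (fun y => dec C y k) predT).
rewrite -[leRHS]mulr1 -[X in _ <= _ * X]E mulr_sumr.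
apply: ler_sum => m _; rewrite ler_wpM2r ?sumr_ge0// mulrC ler_wpM2l ?invr_ge0 ?exprn_ge0//.
by rewrite /msg_prob; case: (m != ord0); rewrite ?mul0r ?mul1r ?invr_ge0.
Qed.

(** Within the budget [thin_jam] dominates [thin], so counting only such words leaves an error under
    the memoryless law. *)
Lemma err_prob_thin n d (C : Defs.code n d) p q th :
  0 <= q <= 1 -> 0 <= th <= 1 ->
  \sum_m \sum_k msg_prob (C := C) R true m * (2 ^+ d)^-1 *
    \sum_(s | (dec C (enc C true m k + s) k != m) && ((wtH s)%:R <= p * n%:R))
      prodw (fun i => th * (if bit (enc C true m k) i then 1 - q else q)) s
  <= err_prob C q (@thin_jam R p th n) true.
Proof.
move=> q01 th01; apply: ler_sum => m _; apply: ler_sum => k _.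
set x := enc C true m k.
under eq_bigr do rewrite -thin_marginal.
rewrite exchange_big/= mulr_sumr; apply: ler_sum => z _.
rewrite mulr_sumr big_mkcondr/=; apply: ler_sum => s _.
have lz := @law_MKZ_ge0 n d C q true m k z q01.
case: ifP => sw; last first.
  by rewrite /thin_jam sw mulr0.
rewrite mulrA -/(law_MKZ q true m k z) ler_wpM2l// /thin_jam sw lerDl.
rewrite mulr_ge0//; apply: sumr_ge0 => t _; exact: thin_ge0.
Qed.

(** The change of measure compares the mass of each decoding region with its mass under the output
    law of the zero word, which averages to at most the inverse number of messages. One [e] is lost
    there, the other to weight overflow. *)
Lemma P_err_lower p q th T eta e : 0 < q < 1 -> 0 < th < 1 -> th * q < p ->
  0 < T -> 0 < eta -> 0 < e ->
  exists N, forall n d (C : Defs.code n d), (N <= n)%N ->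
  light_prob (R := R) C T - 2 * e -
    expR ((T * binary_KL (1 - th * (1 - q)) (th * q) + eta) * Num.sqrt n%:R) *
      (nmsg C)%:R^-1 <= P_err C p q.
Proof.
move=> q01 th01 thp T0 eta0 e0.
have [q01w th01w] : 0 <= q <= 1 /\ 0 <= th <= 1.
  by move/andP: q01 => [? ?]; move/andP: th01 => [? ?]; rewrite !ltW.
have p0 : 0 <= p.
  by apply: ltW; apply: le_lt_trans thp; move/andP: q01w => [? _];
    move/andP: th01w => [? _]; exact: mulr_ge0.
have v01 : 0 < th * q < 1.
  move/andP: q01 => [q0 q1]; move/andP: th01 => [t0 t1].
  by rewrite mulr_gt0//= mulr_ilt1// ltW.
have u01 : 0 < 1 - th * (1 - q) < 1.
  move/andP: q01 => [q0 q1]; move/andP: th01 => [t0 t1].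
  have q1' : 0 < 1 - q by lra.
  have : 0 < th * (1 - q) by exact: mulr_gt0.
  have : th * (1 - q) < 1 by apply: mulr_ilt1; lra.
  by move=> *; apply/andP; split; lra.
set u := 1 - _ in u01 *; set v := th * q in v01 thp *.
have [N1 HN1] := change_of_measure u01 v01 T0 eta0 e0.
have [N2 HN2] := thin_weight q01w th01w thp T0 e0.
exists (maxn N1 N2) => n d C; rewrite geq_max => /andP[nN1 nN2].
set ga := expR _.
apply: le_trans (P_err_ge C q01w (jamming_thin_jam n p0 th01w)).
apply: le_trans (err_prob_thin C p q01w th01w).
pose B m k := \sum_(y : word n | dec C y k == m) prodw (fun=> v) y.
have V0 y : 0 <= prodw (fun _ : 'I_n => v) y.
  by apply: prodw_ge0 => _; move/andP: v01 => [? ?]; rewrite !ltW.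
have SB := sum_decode_le C V0 (sum_prodw _).
(* Each codeword is now bounded separately; for heavy ones the claimed bound is at most 0. *)
apply: (@le_trans _ _ (\sum_m \sum_(k : word d) msg_prob (C := C) R true m * (2 ^+ d)^-1 *
    (((wtH (enc C true m k))%:R <= T * Num.sqrt n%:R)%R%:R - 2 * e - ga * B m k))).
  have -> : \sum_m \sum_(k : word d) msg_prob (C := C) R true m * (2 ^+ d)^-1 *
    (((wtH (enc C true m k))%:R <= T * Num.sqrt n%:R)%R%:R - 2 * e - ga * B m k) =
    light_prob C T - 2 * e - ga * \sum_m \sum_k msg_prob (C := C) R true m * (2 ^+ d)^-1 * B m k.
    have S1 := @sum_msg_key_prob R n d C true.
    rewrite [in RHS](_ : 2 * e = (\sum_m \sum_(k : word d) msg_prob (C := C) R true m * (2 ^+ d)^-1) * (2 * e)); last first.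
      by rewrite S1 mul1r.
    rewrite /light_prob mulr_suml mulr_sumr -!sumrB.
    apply: eq_bigr => m _; rewrite mulr_suml mulr_sumr [X in X - _ - _]big_mkcond -!sumrB.
    apply: eq_bigr => k _; case: ifP => _ /=; ring.
  by rewrite lerD2l lerN2 ler_pM2l ?expR_gt0.
apply: ler_sum => m _; apply: ler_sum => k _.
rewrite ler_wpM2l//; first by rewrite mulr_ge0 ?msg_prob_ge0 ?invr_ge0 ?exprn_ge0.
set x := enc C true m k.
pose al i := th * (if bit x i then 1 - q else q).
have al0 s : 0 <= prodw al s.
  apply: prodw_ge0 => i; rewrite /al; move/andP: q01w => [? ?]; move/andP: th01w => [? ?].
  by case: ifP => _; rewrite mulr_ge0/= ?mulr_ile1//; lra.
have B0 : 0 <= ga * B m k by rewrite mulr_ge0 ?expR_ge0// sumr_ge0.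
have [light|heavy] := leP _ (T * Num.sqrt n%:R); last first.
  apply: (@le_trans _ _ 0); last by apply: sumr_ge0.
  by rewrite sub0r subr_le0; lra.
have W2 := HN2 _ _ nN2 light.
have W1 := HN1 n x (fun y => dec C y k == m) nN1 light.
(* Translation by [x]: a flipped one arrives as a zero, hence the parameter [1 - th * (1 - q)] on
   the support of [x]. *)
have WE : \sum_(s : word n | dec C (x + s) k == m) prodw al s =
    \sum_(y | dec C y k == m) prodw (fun i => if bit x i then u else v) y.
  rewrite [RHS](reindex_inj (addrI x))/=; apply: eq_bigr => s _.
  rewrite -[X in prodw al X](addKr x s) addrC.
  rewrite prodwB; apply: eq_bigr => i _; rewrite /al.
  by case: (bit x i).
(* Every jamming word is decoded correctly, over budget, or counted as an error. *)
have tot : \sum_s prodw al s <=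
   \sum_(s : word n | dec C (x + s) k == m) prodw al s +
   \sum_(s : word n | ~~ ((wtH s)%:R <= p * n%:R)) prodw al s +
   \sum_(s | (dec C (x + s) k != m) && ((wtH s)%:R <= p * n%:R)) prodw al s.
  rewrite [X in _ <= X + _ + _]big_mkcond [X in _ <= _ + X + _]big_mkcond.
  rewrite [X in _ <= _ + X]big_mkcond -!big_split/=.
  apply: ler_sum => s _; have := al0 s.
  by case: (dec C (x + s) k == m); case: ((wtH s)%:R <= p * n%:R) => /=; lra.
rewrite sum_prodw WE in tot.
have W1' : \sum_(y | dec C y k == m) prodw (fun i => if bit x i then u else v) y <=
  ga * B m k + e by [].
have W2' : \sum_(s : word n | ~~ ((wtH s)%:R <= p * n%:R)) prodw al s <= e by [].
suff : 1 - 2 * e - ga * B m k <=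
  \sum_(s | (dec C (x + s) k != m) && ((wtH s)%:R <= p * n%:R)) prodw al s by [].
by move: tot W1' W2'; clear; lra.
Qed.

End ErrorBound.

(** * The converse *)

Section Converse.
Context {R : realType}.
Implicit Types (p q r T eps : R).

Lemma limn_esup_lt (u : (\bar R)^nat) (l : \bar R) : (limn_esup u < l)%E ->
  exists N, forall j, (N <= j)%N -> (u j < l)%E.
Proof.
move=> /ereal_inf_lt[_ [A [N _ NA] <-] ul]; exists N => j Nj.
by apply: le_lt_trans ul; apply: ereal_sup_ubound; exists j => //; exact: NA.
Qed.

Lemma limn_einf_gt (u : (\bar R)^nat) (l : \bar R) : (l < limn_einf u)%E ->
  exists N, forall j, (N <= j)%N -> (l < u j)%E.
Proof.
rewrite /limn_einf lteNr => /limn_esup_lt[N HN].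
by exists N => j /HN; rewrite lteN2.
Qed.

Let ln2_gt0 : 0 < ln 2 :> R.
Proof. by rewrite ln_gt0// ltr1n. Qed.

(** For [u = 1 - p / q * (1 - q)] and [v = p], the second logarithm in [I_B] is that of [u / v] and
    the first that of its quotient by [(1 - u) / (1 - v)]. *)
Lemma I_BE p q : 0 < p <= q -> q < 1 ->
  I_B p q = binary_KL (1 - p / q * (1 - q)) p / ln 2.
Proof.
move=> /andP[p0 pq] q1.
have q0 : 0 < q by lra.
have q1' : 0 < 1 - q by lra.
have p1' : 0 < 1 - p by lra.
have m0 : 0 < q - p + p * q by rewrite ltr_wpDl ?mulr_gt0// subr_ge0.
rewrite /I_B /log2 /binary_KL.
have uE : 1 - p / q * (1 - q) = (q - p + p * q) / q by field; rewrite lt0r_neq0.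
have -> : 1 - (1 - p / q * (1 - q)) = p / q * (1 - q) by ring.
have -> : (1 - p / q * (1 - q)) / p = (q - p + p * q) / (p * q).
  by rewrite uE; field; rewrite !lt0r_neq0.
set Y := (q - p + p * q) / (p * q); set Z := p / q * (1 - q) / (1 - p).
have Y0 : 0 < Y by rewrite divr_gt0 ?mulr_gt0.
have Z0 : 0 < Z by rewrite divr_gt0// mulr_gt0// divr_gt0.
have -> : (q - p + p * q) * (1 - p) / (p ^+ 2 * (1 - q)) = Y / Z.
  by rewrite /Y /Z; field; rewrite !lt0r_neq0.
rewrite ln_div ?posrE//; field; rewrite !lt0r_neq0//.
Qed.

(** The strict inequalities give [th = p' / q < 1] with budget to spare, and light codewords of
    probability bounded away from 0; a larger rate would keep the error away from 0. *)
Lemma achievable_le p p' q (Delta : nat -> nat) eps r T :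
  0 < eps < 1 -> 0 < q < 1 / 2 -> 0 < p' < q -> p' < p ->
  weight_bound q eps < T -> achievable p q Delta eps r ->
  r <= T * I_B p' q.
Proof.
move=> /andP[eps0 eps1] /andP[q0 q2] /andP[p0 pq] pp tT.
case=> b [C [[b0 bS] rC errC covC]].
have q01 : 0 < q < 1 by apply/andP; split; lra.
rewrite leNgt; apply/negP => rT.
set x0 : R := gaussQ_inv ((1 - eps) / 2).
have [Qx0 x00] : gaussQ x0 = (1 - eps) / 2 /\ 0 < x0.
  by apply: gaussQ_invP; apply/andP; split; lra.
pose sd := Num.sqrt (q * (1 - q)).
have sd0 : 0 < sd by rewrite sqrtr_gt0 mulr_gt0//; lra.
have q2' : 0 < 1 - 2 * q by lra.
(* [covert_light] allows every [a < y0] for this [T], and [a > x0] gives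
   [gaussQ a < (1 - eps) / 2]. *)
pose y0 := (1 - 2 * q) * T / (2 * sd).
have xy : x0 < y0.
  rewrite /y0 ltr_pdivlMr ?mulr_gt0// -ltr_pdivrMl//.
  by move: tT; rewrite /weight_bound -/x0 -/sd; congr (_ < _); field; rewrite lt0r_neq0.
pose a := (x0 + y0) / 2.
have [xa ay] : x0 < a /\ a < y0 by rewrite /a; split; lra.
have a0 : 0 < a by lra.
have aT : 2 * (a * sd) < (1 - 2 * q) * T.
  by move: ay; rewrite /y0 ltr_pdivlMr ?mulr_gt0//; lra.
have T0 : 0 < T.
  by apply: le_lt_trans tT; rewrite /weight_bound -/x0 mulr_ge0 ?divr_ge0 ?mulr_ge0 ?ltW.
(* Light codewords get probability above [be - 2 * e]; [P_err_lower] costs [2 * e] and the rate term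
   [e], so [e = be / 10] leaves an error above [be / 2]. *)
pose be := 1 - eps - 2 * gaussQ a.
have be0 : 0 < be by have := gaussQ_decr xa; rewrite Qx0 /be; lra.
pose e := be / 10.
have e0 : 0 < e by rewrite divr_gt0.
pose th := p' / q.
have th01 : 0 < th < 1 by rewrite divr_gt0//= ltr_pdivrMr// mul1r.
have thq : th * q = p' by rewrite /th divfK// lt0r_neq0.
have IE : I_B p' q = binary_KL (1 - th * (1 - q)) p' / ln 2.
  by apply: I_BE; [rewrite p0 ltW|lra].
set KL := binary_KL _ _ in IE.
(* Half of the excess rate pays for the fluctuation of the likelihood ratio, the other half drives
   the exponential to 0. *)
pose eta := (r * ln 2 - T * KL) / 2.
have eta0 : 0 < eta.
  by rewrite divr_gt0// subr_gt0 -ltr_pdivrMr// -mulrA -IE.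
have [N1 HN1] := covert_light q01 a0 T0 e0 aT.
have thp : th * q < p by rewrite thq.
have [N2 HN2] := P_err_lower q01 th01 thp T0 eta0 e0.
have [N3 HN3] := @exists_nat_sqrt R ((e * eta)^-1).
have [N4 HN4] : exists N, forall j, (N <= j)%N -> ((P_err (C j) p q)%:E < (be / 2)%:E)%E.
  by apply: limn_esup_lt; rewrite errC lte_fin divr_gt0.
have [N5 HN5] : exists N, forall j, (N <= j)%N ->
    ((1 - eps - e)%:E < (min_detection (C j) q)%:E)%E.
  by apply: limn_einf_gt; apply: lt_le_trans covC; rewrite lte_fin; lra.
(* Blocklengths dominate their index, so bounds on [n] are met from some index on. *)
have bj j : (j <= b j)%N.
  by elim: j => // j IH; apply: (leq_ltn_trans IH); apply: bS.
pose j := maxn N1 (maxn N2 (maxn N3 (maxn N4 N5))).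
have [j1 j2 j3 [j4 j5]] : [/\ N1 <= b j, N2 <= b j, N3 <= b j & N4 <= j /\ N5 <= j]%N.
  by split; rewrite ?(leq_trans _ (bj j))//; [| | |split]; rewrite /j !leq_max leqnn ?orbT.
have {}HN1 := HN1 _ _ (C j) j1.
have {}HN2 := HN2 _ _ (C j) j2.
have {}HN3 := HN3 _ j3.
have := HN4 _ j4; have := HN5 _ j5; rewrite !lte_fin => {}HN5 {}HN4.
rewrite thq -/KL in HN2.
set sn := Num.sqrt ((b j)%:R : R) in HN2 HN3.
have sn0 : 0 < sn by rewrite sqrtr_gt0 ltr0n b0.
have M0 : 0 < (nmsg (C j))%:R :> R by rewrite ltr0n nmsg_gt0.
have rate : expR ((T * KL + eta) * sn) * (nmsg (C j))%:R^-1 <= e.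
  have lnM : r * ln 2 * sn <= ln (nmsg (C j))%:R.
    have := rC j; rewrite /rel_throughput /log2 -/sn ler_pdivlMr// ler_pdivlMr//.
    by rewrite mulrAC.
  rewrite -[X in _ * X^-1](lnK (x := _%:R)) ?posrE// -expRN -expRD.
  apply: (@le_trans _ _ (expR (- (eta * sn)))).
    rewrite ler_expR.
    have : r * ln 2 * sn = (T * KL + eta) * sn + eta * sn by rewrite /eta; field.
    lra.
  rewrite expRN -[e]invrK lef_pV2 ?posrE ?expR_gt0 ?invr_gt0//.
  apply: le_trans (expR_ge1Dx _).
  have : e^-1 <= eta * sn.
    by rewrite -ler_pdivrMl// -invfM mulrC.
  lra.
move: HN1 HN2 HN5 HN4 rate; rewrite /e /be; lra.
Qed.

Lemma I_B_ge0 p q : 0 < p <= q -> q < 1 -> 0 <= I_B p q.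
Proof.
move=> /andP[p0 pq] q1; have q0 : 0 < q by lra.
rewrite I_BE ?p0// mulr_ge0 ?invr_ge0 ?(ltW ln2_gt0)//.
have pq0 : 0 < p / q * (1 - q) by rewrite mulr_gt0 ?divr_gt0// subr_gt0.
have pq1 : p / q * (1 - q) < 1.
  rewrite (@le_lt_trans _ _ (1 - q))//; last by lra.
  by rewrite ler_piMl ?subr_ge0 ?(ltW q1)// ler_pdivrMr// mul1r.
by apply: binary_KL_ge0; apply/andP; split; lra.
Qed.

Lemma continuous_I_B p q : 0 < p <= q -> q < 1 -> {for p, continuous (fun x : R => I_B x q)}.
Proof.
move=> /andP[p0 pq] q1.
have q0 : 0 < q by lra.
have m0 : 0 < q - p + p * q by rewrite ltr_wpDl ?mulr_gt0// subr_ge0.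
have cln (f : R -> R) : {for p, continuous f} -> 0 < f p ->
    {for p, continuous (fun x => log2 (f x))}.
  move=> cf fp; apply: cvgMl.
  by apply: (@continuous_comp _ _ _ f (@ln R)) => //; exact: continuous_ln.
have cid : {for p, continuous (fun x : R => x)} by exact: cvg_id.
have ccst (c : R) : {for p, continuous (fun x : R => c)} by exact: cvg_cst.
have cm : {for p, continuous (fun x : R => q - x + x * q)}.
  apply: cvgD; first by apply: cvgB; [exact: ccst|exact: cid].
  by apply: cvgM; [exact: cid|exact: ccst].
have c1m : {for p, continuous (fun x : R => 1 - x)}.
  by apply: cvgB; [exact: ccst|exact: cid].
have cq : {for p, continuous (fun x : R => x * q)}.
  by apply: cvgM; [exact: cid|exact: ccst].
have csq : {for p, continuous (fun x : R => x ^+ 2 * (1 - q))}.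
  by apply: cvgM; [exact: exprn_continuous|exact: ccst].
apply: cvgD; first apply: cvgM.
- apply: cvgM; last exact: ccst.
  by apply: cvgM; [exact: cid|exact: ccst].
- apply: cln; last first.
    by rewrite divr_gt0 ?mulr_gt0 ?exprn_gt0// subr_gt0//; lra.
  apply: cvgM; first by apply: cvgM; [exact: cm|exact: c1m].
  apply: cvgV; last exact: csq.
  by rewrite mulf_neq0 ?expf_neq0 ?lt0r_neq0// subr_gt0.
- apply: cln; last by rewrite divr_gt0 ?mulr_gt0.
  apply: cvgM; first exact: cm.
  apply: cvgV; last exact: cq.
  by rewrite mulf_neq0 ?lt0r_neq0.
Qed.

(** Since [achievable_le] needs strict inequalities, [p'] tends to the minimum from the left, then
    [T] decreases to [weight_bound q eps]. *)
Lemma achievable_le_min p q (Delta : nat -> nat) eps r :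
  0 < eps < 1 -> 0 < p -> 0 < q < 1 / 2 -> achievable p q Delta eps r ->
  r <= weight_bound q eps * I_B (Num.min p q) q.
Proof.
move=> eps01 p0 q01 ach.
have [q0 q2] : 0 < q /\ q < 1 / 2 by move/andP: q01.
set m := Num.min p q.
have m0 : 0 < m by rewrite lt_min p0.
have mq : m <= q by rewrite ge_min lexx orbT.
have mp : m <= p by rewrite ge_min lexx.
have step T : weight_bound q eps < T -> r <= T * I_B m q.
  move=> tT.
  have cI : (fun x => T * I_B x q) x @[x --> m^'-] --> T * I_B m q.
    apply: cvg_at_left_filter; apply: cvgM; first exact: cvg_cst.
    by apply: continuous_I_B; rewrite ?m0//; lra.
  apply: (cvgr_to_ge cI); near=> x.
  have x0 : 0 < x by near: x; exact: nbhs_left_gt.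
  have xm : x < m by near: x; exact: nbhs_left_lt.
  apply: achievable_le ach => //; last exact: lt_le_trans mp.
  by rewrite x0 (lt_le_trans xm).
have I0 : 0 <= I_B m q by apply: I_B_ge0; [rewrite m0|lra].
apply/ler_addgt0Pr => e e0.
have I1 : 0 < I_B m q + 1 by lra.
(* The 1 in the divisor is there because [I_B m q] may vanish. *)
have := step (weight_bound q eps + e / (I_B m q + 1)).
rewrite ltrDl divr_gt0// => /(_ isT)/le_trans; apply.
rewrite mulrDl lerD2l mulrAC ler_pdivrMr// ler_pM2l//; lra.
Unshelve. all: by end_near. Qed.

End Converse.

Theorem theorem2 (R : realType) (eps p q : R) (Delta : nat -> nat)
  (eps01 : 0 < eps < 1) (p01 : 0 < p < 1 / 2) (q01 : 0 < q < 1 / 2) :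
  (q <= p -> covert_capacity p q Delta eps = 0%E) /\
  (p < q ->
    (covert_capacity p q Delta eps <= (weight_bound q eps * I_B p q)%:E)%E).
Proof.
have p0 : 0 < p by have /andP[] := p01.
have /andP[q0 q2] := q01.
have ub r : achievable p q Delta eps r ->
    r <= weight_bound q eps * I_B (Num.min p q) q.
  exact: achievable_le_min.
split=> [qp|pq].
  rewrite /covert_capacity max_l//; apply: ge_ereal_sup => _ [r /ub + <-].
  rewrite min_r// lee_fin => /le_trans; apply.
  (* Full copying gives both inputs the output law Bern(q), so the divergence vanishes. *)
  have -> : I_B q q = 0.
    rewrite I_BE ?q0 ?lexx//; last by lra.
    rewrite divff ?lt0r_neq0// mul1r subKr /binary_KL !divff ?lt0r_neq0 ?subr_gt0//; last by lra.
    by rewrite ln1 !mulr0 addr0 mul0r.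
  by rewrite mulr0.
(* The capacity is a maximum with 0, so the bound must also be shown non-negative. *)
rewrite /covert_capacity ge_max lee_fin; apply/andP; split.
  have y01 : 0 < (1 - eps) / 2 < 1 / 2 by move/andP: eps01 => [? ?]; apply/andP; split; lra.
  have [_ x0] := gaussQ_invP y01.
  apply: mulr_ge0; last by apply: I_B_ge0; [rewrite p0 ltW|lra].
  by rewrite mulr_ge0 ?(ltW x0)// divr_ge0 ?mulr_ge0//; lra.
apply: ge_ereal_sup => _ [r /ub + <-].
by rewrite (min_l (ltW pq)) lee_fin.
Qed.
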